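(* Let $T$ be a topological tree and let $f\colon T\to T$ be a continuous map. Then the induced system $(C(T),\tilde f)$ is almost equicontinuous.
   Context: A topological graph is a continuum (compact connected metric space) homeomorphic to the geometric carrier of a (finite) one-dimensional simplicial complex; a topological tree is a topological graph containing no subset homeomorphic to the circle. $C(T)$ is the set of all nonempty subcontinua of $T$ (including singletons) with the Hausdorff metric, and $\tilde f(A)=f(A)$ for $A\in C(T)$. For a continuous self-map $g$ of a compact metric space $(X,\rho)$, a point $x\in X$ is equicontinuous if for every $\epsilon>0$ there is $\delta>0$ such that $\rho(g^n(y),g^n(x))<\epsilon$ for all $y\in B(x,\delta)$ and all $n\ge0$. The system $(X,g)$ is almost equicontinuous if the set of equicontinuous points is residual in $X$ (equivalently, a dense $G_\delta$ subset of $X$). *)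

(* Defs.v *)
From HB Require Import structures.
From mathcomp Require Import all_boot all_order all_algebra finmap.
From mathcomp Require Import all_classical all_reals topology.
From mathcomp Require Import interval_inference normedtype.

Set Implicit Arguments.
Unset Strict Implicit.
Unset Printing Implicit Defensive.

Import Order.TTheory GRing.Theory Num.Theory.
Import numFieldTopology.Exports numFieldNormedType.Exports.

Local Open Scope classical_set_scope.
Local Open Scope ring_scope.

Section Homeomorphism.
Variables X Y : topologicalType.

(* Subspaces are represented by sets and maps between them by total functions
   whose values outside the subspace are irrelevant. *)
Definition homeomorphic (A : set X) (B : set Y) : Prop :=
  exists (f : X -> Y) (g : Y -> X),
    [/\ set_fun A B f, set_fun B A g,
        (forall x, A x -> g (f x) = x), (forall y, B y -> f (g y) = y) &
        {within A, continuous f} /\ {within B, continuous g}].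

End Homeomorphism.

Section SimplicialComplex.
Variables (R : realType) (n : nat).

(* A simplex of R^n is given by its finite set of vertices. *)
Implicit Types s t : {fset 'rV[R]_n}.

Definition affinely_independent s : Prop :=
  forall c : 'rV[R]_n -> R,
    \sum_(v <- s) c v = 0 -> \sum_(v <- s) c v *: v = 0 ->
    forall v, v \in s -> c v = 0.

Definition convex_hull s : set 'rV[R]_n :=
  [set x | exists c : 'rV[R]_n -> R,
     [/\ forall v, v \in s -> 0 <= c v, \sum_(v <- s) c v = 1 &
         x = \sum_(v <- s) c v *: v]].

(* In the last clause, [convex_hull fset0] is empty, so two simplices are
   either disjoint or meet in a common face. *)
Definition simplicial_complex (K : {fset {fset 'rV[R]_n}}) : Prop :=
  [/\ forall s, s \in K -> s != fset0,
      forall s, s \in K -> affinely_independent s,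
      forall s t, s \in K -> (t `<=` s)%fset -> t != fset0 -> t \in K &
      forall s t, s \in K -> t \in K ->
        convex_hull s `&` convex_hull t = convex_hull (s `&` t)%fset].

Definition one_dimensional (K : {fset {fset 'rV[R]_n}}) : Prop :=
  (forall s, s \in K -> (#|` s| <= 2)%N) /\
  (exists2 s, s \in K & #|` s| = 2%N).

Definition geometric_carrier (K : {fset {fset 'rV[R]_n}}) : set 'rV[R]_n :=
  \bigcup_(s in [set` K]) convex_hull s.

End SimplicialComplex.

Definition unit_circle (R : realType) : set (R * R) :=
  [set p | p.1 ^+ 2 + p.2 ^+ 2 = 1].

Definition continuum (X : topologicalType) (A : set X) : Prop :=
  [/\ A !=set0, compact A & connected A].

Definition topological_graph (R : realType) (T : metricType R) : Prop :=
  continuum [set: T] /\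
  exists (n : nat) (K : {fset {fset 'rV[R]_n}}),
    [/\ simplicial_complex K, one_dimensional K &
        homeomorphic [set: T] (geometric_carrier K)].

Definition topological_tree (R : realType) (T : metricType R) : Prop :=
  topological_graph T /\
  ~ exists A : set T, homeomorphic A (@unit_circle R).

Record subcontinuum (X : topologicalType) := Subcontinuum {
  subcontinuum_set :> set X ;
  subcontinuumP : continuum subcontinuum_set }.

HB.instance Definition _ (X : topologicalType) :=
  gen_eqMixin (subcontinuum X).
HB.instance Definition _ (X : topologicalType) :=
  gen_choiceMixin (subcontinuum X).

Lemma subcontinuum_inj (X : topologicalType) (A B : subcontinuum X) :
  A = B :> set X -> A = B.
Proof.
case: A B => [A hA] [B hB] /= AB; move: hA hB; rewrite AB => hA hB.
by congr Subcontinuum; exact: Prop_irrelevance.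
Qed.

Section HausdorffMetric.
Variables (R : realType) (T : metricType R).
Implicit Types (A B : set T) (e : R).

Definition set_neighborhood A e : set T := \bigcup_(a in A) ball a e.

Definition hausdorff_radius A B : set R :=
  [set e | [/\ 0 < e, A `<=` set_neighborhood B e
                    & B `<=` set_neighborhood A e]].

Definition hausdorff_dist A B : R := inf (hausdorff_radius A B).

Lemma hausdorff_radius_lbound A B : has_lbound (hausdorff_radius A B).
Proof. by exists 0 => e [/ltW]. Qed.

Lemma set_neighborhoodW A e1 e2 : e1 <= e2 ->
  set_neighborhood A e1 `<=` set_neighborhood A e2.
Proof. by move=> e12 x [a Aa ax]; exists a => //; exact: le_ball ax. Qed.

Lemma mdist_ball_center (x : T) e : 0 < e -> ball x e x.
Proof. by move=> e0; exact: (@ball_center _ _ x (PosNum e0)). Qed.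

Lemma compact_subset_neighborhood A B : compact A -> B !=set0 ->
  exists2 e, 0 < e & A `<=` set_neighborhood B e.
Proof.
move=> /compact_near_coveringP cA [b Bb].
have /= := cA _ \oo (fun n x => ball b n%:R x) _.
have H x : A x -> \forall x' \near x & n \near \oo, ball b n%:R x'.
  move=> _; pose N := (Num.truncn (mdist b x + 1)).+1.
  exists (ball x 1, [set n | (N <= n)%N]).
    by split; [exact: nbhsx_ballx|exists N].
  move=> [y n] /= [xy Nn]; apply: (@le_ball _ _ b (mdist b x + 1)).
    by apply: ltW; apply: lt_le_trans (truncnS_gt _) _; rewrite ler_nat.
  rewrite ballEmdist /= (le_lt_trans (metric_triangle _ x _))// ltrD2l.
  by move: xy; rewrite ballEmdist.
move=> /(_ _ H) [N _ /(_ N.+1) /(_ (leqnSn _)) AN].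
by exists N.+1%:R => // x /AN bx; exists b.
Qed.

Lemma hausdorff_radius_neq0 A B : continuum A -> continuum B ->
  hausdorff_radius A B !=set0.
Proof.
move=> [A0 cA _] [B0 cB _].
have [e1 e10 h1] := compact_subset_neighborhood cA B0.
have [e2 e20 h2] := compact_subset_neighborhood cB A0.
exists (Num.max e1 e2); split; first by rewrite lt_max e10.
- by apply: subset_trans h1 _; apply: set_neighborhoodW; rewrite le_max lexx.
- by apply: subset_trans h2 _; apply: set_neighborhoodW; rewrite le_max lexx orbT.
Qed.

Lemma hausdorff_distxx A : hausdorff_dist A A = 0.
Proof.
have H e : 0 < e -> hausdorff_radius A A e.
  by move=> e0; split=> // x Ax; exists x => //; exact: mdist_ball_center.
apply/eqP; rewrite eq_le; apply/andP; split.
  apply/ler_addgt0Pl => e e0; rewrite addr0.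
  by apply: (ge_inf (@hausdorff_radius_lbound A A)); exact: H.
by apply: lb_le_inf => [|e [/ltW]]; first by exists 1; exact: H.
Qed.

Lemma hausdorff_dist_sym A B : hausdorff_dist A B = hausdorff_dist B A.
Proof.
by congr inf; apply/seteqP; split=> e [].
Qed.

Lemma hausdorff_dist0_sub A B : continuum A -> continuum B ->
  hausdorff_dist A B = 0 -> A `<=` B.
Proof.
move=> cA cB AB0.
have clB : closed B.
  by case: cB => _ + _; apply: compact_closed; exact: metric_hausdorff.
move=> x Ax; apply: clB => U /nbhs_ballP[e /= e0 xeU].
have : inf (hausdorff_radius A B) < e by rewrite -/(hausdorff_dist A B) AB0.
move=> /(inf_lt (hausdorff_radius_neq0 cA cB))[d [d0 /(_ x Ax)[b Bb bx] _] de].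
exists b; split => //; apply: xeU; apply: ball_sym.
exact: le_ball (ltW de) _ bx.
Qed.

Lemma hausdorff_dist_triangle A B C :
  continuum A -> continuum B -> continuum C ->
  hausdorff_dist A C <= hausdorff_dist A B + hausdorff_dist B C.
Proof.
move=> cA cB cC; apply/ler_addgt0Pl => e e0.
have e20 : 0 < e / 2 by rewrite divr_gt0.
have lt_half x : x < x + e / 2 by rewrite ltrDl.
have [d [d0 AB BA] dlt] := inf_lt (hausdorff_radius_neq0 cA cB) (lt_half (hausdorff_dist A B)).
have [d' [d'0 BC CB] d'lt] := inf_lt (hausdorff_radius_neq0 cB cC) (lt_half (hausdorff_dist B C)).
apply: (@le_trans _ _ (d + d')).
  apply: (ge_inf (@hausdorff_radius_lbound A C)); split.
  - exact: addr_gt0.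
  - move=> x /AB[b /BC[c Cc cb] bx]; exists c => //.
    by rewrite addrC; exact: ball_triangle cb bx.
  - move=> x /CB[b /BA[a Aa ab] bx]; exists a => //.
    exact: ball_triangle ab bx.
apply: (le_trans (lerD (ltW dlt) (ltW d'lt))).
by rewrite addrACA -splitr addrC.
Qed.

Definition subcontinuum_dist (A B : subcontinuum T) : R := hausdorff_dist A B.

Lemma subcontinuum_distxx (A : subcontinuum T) : subcontinuum_dist A A = 0.
Proof. exact: hausdorff_distxx. Qed.

Lemma subcontinuum_dist_positivity (A B : subcontinuum T) :
   subcontinuum_dist A B = 0 -> A = B.
Proof.
move=> AB0; apply: subcontinuum_inj; apply/seteqP; split.
- by apply: hausdorff_dist0_sub AB0; exact: subcontinuumP.
- move: AB0; rewrite /subcontinuum_dist hausdorff_dist_sym.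
  by apply: hausdorff_dist0_sub; exact: subcontinuumP.
Qed.

Lemma subcontinuum_dist_sym (A B : subcontinuum T) :
  subcontinuum_dist A B = subcontinuum_dist B A.
Proof. exact: hausdorff_dist_sym. Qed.

Lemma subcontinuum_dist_triangle (B A C : subcontinuum T) :
  subcontinuum_dist A C <= subcontinuum_dist A B + subcontinuum_dist B C.
Proof. by apply: hausdorff_dist_triangle; exact: subcontinuumP. Qed.

HB.instance Definition _ := isMetric.Build R (subcontinuum T)
  subcontinuum_distxx subcontinuum_dist_positivity subcontinuum_dist_sym
  subcontinuum_dist_triangle.

End HausdorffMetric.

Lemma continuum_image (X Y : topologicalType) (f : X -> Y) (A : set X) :
  continuous f -> continuum A -> continuum (f @` A).
Proof.
move=> cf [[a Aa] cA conA]; split; first by exists (f a); exists a.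
- by apply: continuous_compact => //; exact: continuous_subspaceT.
- by apply: connected_continuous_connected => //; exact: continuous_subspaceT.
Qed.

Definition induced_map (X : topologicalType) (f : X -> X) (cf : continuous f)
    (A : subcontinuum X) : subcontinuum X :=
  Subcontinuum (continuum_image cf (subcontinuumP A)).

Section AlmostEquicontinuity.
Variables (R : realType) (X : metricType R).

Definition equicontinuity_point (g : X -> X) (x : X) : Prop :=
  forall e : R, 0 < e -> exists2 d : R, 0 < d &
    forall y, ball x d y -> forall n, mdist (iter n g y) (iter n g x) < e.

Definition residual (E : set X) : Prop :=
  exists U : nat -> set X,
    (forall n, open (U n) /\ dense (U n)) /\ \bigcap_n U n `<=` E.

Definition almost_equicontinuous (g : X -> X) : Prop :=
  residual [set x | equicontinuity_point g x].

End AlmostEquicontinuity.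

(* Main.v *)
(* To each edge of the tree attach the function c : T -> [0, 1] giving the
   position on that edge of the nearest-point projection. Up to small errors a
   subcontinuum is determined by the ranges of these functions, and nearby
   subcontinua B, B' differ only in short arcs near their finitely many ends.
   If f^n(B) and f^n(B') are far apart, then f^n stretches such an arc across one
   of finitely many intervals I of a grid on the edges. An arc can be shrunk so
   that it is stretched across I at two different times only if I contains a
   periodic point, so after shrinking only intervals with a periodic point
   occur. Pick a common period q. Once a periodic point is in f^n(B), it is in
   f^(n + kq)(B) for all k; as there are finitely many grid intervals and residues
   mod q, on a small enough open set of continua nothing new is caught after some
   time N, so no interval is crossed after N. The first N iterates are
   handled by continuity. *)
Require Import Defs.
From mathcomp Require Import all_boot all_order all_algebra finmap.
From mathcomp Require Import all_classical all_reals topology.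
From mathcomp Require Import interval_inference normedtype derive.
From mathcomp Require Import ring lra.

Set Implicit Arguments.
Unset Strict Implicit.
Unset Printing Implicit Defensive.

Import Order.TTheory GRing.Theory Num.Theory.
Import numFieldTopology.Exports numFieldNormedType.Exports.

Local Open Scope classical_set_scope.
Local Open Scope ring_scope.

(** * Finite refinement, intermediate values and uniform continuity *)

(** Each [P i] survives passing to a smaller element, so finitely many requirements can be met one
    after another. Applied to intervals, periods under divisibility, open families and radii. *)
Lemma shrink_finite (I : finType) (D : Type) (G : D -> Prop)
    (le : D -> D -> Prop) (P : I -> D -> Prop) :
  (forall x, le x x) -> (forall y x z, le x y -> le y z -> le x z) ->
  (forall i x y, le y x -> P i x -> P i y) ->
  (forall i x, G x -> exists y, [/\ G y, le y x & P i y]) ->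
  forall x, G x -> exists y, [/\ G y, le y x & forall i, P i y].
Proof.
move=> rle tle mP sP x Gx.
suff [y [Gy yx Py]] : exists y, [/\ G y, le y x & forall i, i \in enum I -> P i y].
  by exists y; split=> // i; apply: Py; rewrite mem_enum.
elim: (enum I) => [|i s [y [Gy yx Py]]]; first by exists x.
have [z [Gz zy Pz]] := sP i y Gy; exists z; split => //; first exact: tle zy yx.
by move=> j; rewrite inE => /predU1P[->//|/Py]; exact: mP.
Qed.

Lemma connected_ivt (X : topologicalType) (R : realType) (B : set X)
    (phi : X -> R) (x y : X) (v : R) :
  connected B -> {within B, continuous phi} -> B x -> B y ->
  phi x <= v -> v <= phi y -> exists2 z, B z & phi z = v.
Proof.
move=> cB cphi Bx By xv vy.
have /connected_intervalP ii := connected_continuous_connected cB cphi.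
have : (phi @` B) v by apply: (ii (phi x) (phi y)); [exists x|exists y|rewrite xv].
by move=> [z Bz zv]; exists z.
Qed.

(** Heine-Cantor with only one of the two points confined to [K]. *)
Lemma compact_uniform_continuity (R : realType) (X Y : pseudoMetricType R)
    (K : set X) (g : X -> Y) (e : R) : compact K -> continuous g -> 0 < e ->
  exists2 d, 0 < d & forall x y, K x -> ball x d y -> ball (g x) e (g y).
Proof.
move=> /compact_near_coveringP cK cg e0.
have e20 : 0 < e / 2 by lra.
have := cK _ (0 : R)^'+ (fun d x => forall y, ball x d y -> ball (g x) e (g y)) _.
case=> [x _|d /= d0 H].
  have /nbhs_ballP[r /= r0 rP] := cg x _ (nbhsx_ballx (g x) _ e20).
  have r20 : 0 < r / 2 by lra.
  exists (ball x (r / 2), [set d : R | 0 < d < r / 2]).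
    split; first exact: nbhsx_ballx.
    exists (r / 2) => //= d; rewrite /ball_ /= sub0r normrN => + d0.
    by rewrite gtr0_norm// d0.
  move=> [x' d] /= [xx' /andP[d0 dr]] y x'y.
  rewrite (splitr e); apply: (@ball_triangle _ _ (g x)).
    by apply: ball_sym; apply: rP; apply: le_ball xx'; lra.
  apply: rP; rewrite (splitr r); apply: ball_triangle xx' _.
  by apply: le_ball x'y; lra.
exists (d / 2); first by lra.
move=> x y Kx; apply: (H (d / 2)) => //=; last by lra.
by rewrite /ball_ /= sub0r normrN gtr0_norm; lra.
Qed.

Notation "x \In B" := (subcontinuum_set B x) (at level 70, no associativity).

(** * Minima of functions on continua *)

Section Infimum.
Context (R : realType) (X : topologicalType).
Implicit Types (B : subcontinuum X) (phi : X -> R).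

(** The lower end of the range of [phi]. Upper ends appear as lower ends of the reversed coordinate,
    every edge being listed in both orientations. *)
Definition min_on phi (B : set X) : R := inf (phi @` B).

Lemma min_on_attained phi B : continuous phi ->
  exists2 x, x \In B & phi x = min_on phi B.
Proof.
move=> cphi; have [B0 cB _] := subcontinuumP B.
have [x xB xmin] := compact_EVT_min B0 cB (continuous_subspaceT cphi).
rewrite inE in xB; exists x => //.
have lb : lbound (phi @` B) (phi x).
  by move=> _ [y By <-]; apply: xmin; rewrite inE.
apply/eqP; rewrite eq_le lb_le_inf//=; last by exists (phi x), x.
by apply: ge_inf; [exists (phi x)|exists x].
Qed.

Lemma min_on_le phi B x : continuous phi -> x \In B -> min_on phi B <= phi x.
Proof.
move=> cphi Bx; have [B0 cB _] := subcontinuumP B.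
have [z zB zmin] := compact_EVT_min B0 cB (continuous_subspaceT cphi).
apply: ge_inf; last by exists x.
by exists (phi z) => _ [y By <-]; apply: zmin; rewrite inE.
Qed.

Lemma min_on_unique phi B x : continuous phi -> x \In B ->
  (forall y, y \In B -> phi x <= phi y) -> min_on phi B = phi x.
Proof.
move=> cphi Bx h; apply/eqP; rewrite eq_le min_on_le//=.
by have [y By <-] := min_on_attained B cphi; apply: h.
Qed.

End Infimum.

(** * Open conditions on continua in the Hausdorff metric *)

Section Hyperspace.
Context (R : realType) (T : metricType R).
Implicit Types (A B : subcontinuum T) (phi : T -> R).

Lemma subcontinuum_ballP A B e x : ball A e B -> x \In A ->
  exists2 y, y \In B & mdist x y < e.
Proof.
rewrite ballEmdist /= => AB Ax.
have := inf_lt (hausdorff_radius_neq0 (subcontinuumP A) (subcontinuumP B)) AB.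
move=> [d [d0 /(_ x Ax)[y By yx] _] de]; exists y => //.
by move: yx; rewrite ballEmdist /= metric_sym => /lt_trans; apply.
Qed.

Lemma subcontinuum_mdist_le A B e : 0 < e ->
  (forall x, x \In A -> exists2 y, y \In B & mdist x y < e) ->
  (forall x, x \In B -> exists2 y, y \In A & mdist x y < e) -> mdist A B <= e.
Proof.
move=> e0 AB BA; apply: (ge_inf (@hausdorff_radius_lbound _ _ A B)); split => //.
- by move=> x /AB[y By xy]; exists y => //; rewrite ballEmdist /= metric_sym.
- by move=> x /BA[y Ay xy]; exists y => //; rewrite ballEmdist /= metric_sym.
Qed.

Lemma open_meets (O : set T) : open O ->
  open [set B : subcontinuum T | exists2 x, x \In B & O x].
Proof.
rewrite !openE => oO B [x Bx /oO] /nbhs_ballP[e /= e0 eO].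
apply/nbhs_ballP; exists e => //= B' /subcontinuum_ballP /(_ Bx)[y B'y xy].
by exists y => //; apply: eO; rewrite ballEmdist.
Qed.

Lemma min_on_near phi (e : R) : compact [set: T] -> continuous phi -> 0 < e ->
  exists2 d, 0 < d & forall B B', ball B d B' -> min_on phi B' < min_on phi B + e.
Proof.
move=> cT cphi e0.
have [d d0 H] := compact_uniform_continuity cT cphi e0; exists d => // B B' BB'.
have [x Bx <-] := min_on_attained B cphi.
have [y B'y xy] := subcontinuum_ballP BB' Bx.
apply: le_lt_trans (min_on_le cphi B'y) _.
have := H x y Logic.I; rewrite ballEmdist => /(_ xy); rewrite /ball /= => h.
by rewrite -ltrBlDl (le_lt_trans (ler_norm _))// distrC.
Qed.

Lemma open_min_on_lt phi (v : R) : compact [set: T] -> continuous phi ->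
  open [set B : subcontinuum T | min_on phi B < v].
Proof.
move=> cT cphi; rewrite openE => B /=; rewrite -subr_gt0 => vB.
have [d d0 H] := min_on_near cT cphi vB.
by apply/nbhs_ballP; exists d => //= B' /H; rewrite addrC subrK.
Qed.

Lemma open_min_on_gt phi (v : R) : compact [set: T] -> continuous phi ->
  open [set B : subcontinuum T | v < min_on phi B].
Proof.
move=> cT cphi; rewrite openE => B /=; rewrite -subr_gt0 => vB.
have [d d0 H] := min_on_near cT cphi vB.
by apply/nbhs_ballP; exists d => //= B' /ball_sym /H h; rewrite /mkset; lra.
Qed.

Lemma iter_induced_map (f : T -> T) (cf : continuous f) n A :
  iter n (induced_map cf) A = iter n f @` A :> set T.
Proof.
elim: n => [|n IH] /=; first by rewrite image_id.
by rewrite IH image_comp.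
Qed.

Lemma continuous_iter (f : T -> T) n : continuous f -> continuous (iter n f).
Proof.
move=> cf; elim: n => [|n IH] x /=; first exact: cvg_id.
by apply: continuous_comp; [exact: IH|exact: cf].
Qed.

End Hyperspace.

(** * Dynamics in edge coordinates *)

Section Coordinates.
Context (R : realType) (T : metricType R).

(* [c i x] is the position on edge [i] of the projection of [x], and [s i]
   parametrizes the edge. The last clause is one-sided, so every edge has to be
   listed with both orientations. *)
Definition edge_coordinates (E : finType) (c : E -> T -> R) (s : E -> R -> T)
    : Prop :=
  [/\ forall i, continuous (c i) /\ continuous (s i),
      forall i x, 0 <= c i x <= 1,
      forall i u, 0 <= u <= 1 -> c i (s i u) = u,
      forall i x, 0 < c i x < 1 -> s i (c i x) = x &
      forall e : R, 0 < e -> exists2 d : R, 0 < d &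
        forall (B : set T) x, B !=set0 -> connected B ->
          (forall y, B y -> e <= mdist x y) ->
          exists i, forall y, B y -> c i x + d <= c i y].

End Coordinates.

Definition grid (R : realType) (m k : nat) : R := k%:R / m%:R.

Lemma grid_between (R : realType) (m : nat) (a d : R) :
  0 <= a -> 0 < d -> a + d <= 1 -> 2 / d < m%:R ->
  exists k : 'I_m, [/\ a < grid R m k, grid R m k < grid R m k.+1
                      & grid R m k.+1 < a + d].
Proof.
move=> a0 d0 ad1 md.
have m0 : 0 < m%:R :> R by apply: lt_trans md; rewrite divr_gt0.
have md2 : 2 < d * m%:R by rewrite -ltr_pdivrMl// mulrC.
(* The first integer above [a * m]; its successor exceeds [a * m] by at most 2, which is less than
   [d * m]. *)
pose k := (Num.truncn (a * m%:R)).+1.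
have am0 : 0 <= a * m%:R by rewrite mulr_ge0// ltW.
have kl : a * m%:R < k%:R by apply: truncnS_gt.
have ku : k%:R <= a * m%:R + 1.
  by rewrite /k -natr1 lerD2r truncn_le.
have km : (k < m)%N.
  rewrite -(ltr_nat R); apply: (le_lt_trans ku); nra.
exists (Ordinal km); rewrite /grid /=.
rewrite ltr_pdivlMr// ltr_pM2r ?invr_gt0// ltr_nat ltr_pdivrMr//.
by split => //; rewrite -natr1; nra.
Qed.

Section Dynamics.
Context (R : realType) (T : metricType R) (E : finType).
Variables (c : E -> T -> R) (s : E -> R -> T) (f : T -> T).
Hypothesis cs : edge_coordinates c s.
Hypothesis cf : continuous f.

Let cc i : continuous (c i). Proof. by have [/(_ i)[]] := cs. Qed.
Let sc i : continuous (s i). Proof. by have [/(_ i)[]] := cs. Qed.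
Let cbound i x : 0 <= c i x <= 1. Proof. by have [_ /(_ i x)] := cs. Qed.
Let sK i u : 0 <= u <= 1 -> c i (s i u) = u.
Proof. by have [_ _ /(_ i u)] := cs. Qed.
Let cK i x : 0 < c i x < 1 -> s i (c i x) = x.
Proof. by have [_ _ _ /(_ i x)] := cs. Qed.

(** For continuous [g] the image of [J] then covers [[a, b]]; [u] and [v] may come in either
    order. *)
Definition crosses (g : R -> R) (J : R * R) (a b : R) : Prop :=
  exists u v, [/\ J.1 <= u <= J.2, J.1 <= v <= J.2, g u <= a & b <= g v].

Definition periodic_between i (q : nat) (a b : R) : Prop :=
  exists2 z, iter q f z = z & a <= c i z <= b.

Lemma continuous_edge_map i j n :
  continuous (fun u => c i (iter n f (s j u))).
Proof.
move=> u; apply: (@continuous_comp _ _ _ (fun u => iter n f (s j u)) (c i)).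
  by apply: continuous_comp; [exact: sc|exact: continuous_iter].
exact: cc.
Qed.

(** Since [w] differs from both end values, [r] avoids [u] and [v], which leaves room for an
    interval around [r]. *)
Lemma edge_map_between i j n u v w (a b : R) :
  a < w < b -> c i (iter n f (s j u)) <= a -> b <= c i (iter n f (s j v)) ->
  exists2 r, c i (iter n f (s j r)) = w & Num.min u v < r < Num.max u v.
Proof.
move=> /andP[aw wb] ua vb.
have [||||r] := @connected_ivt _ R `[Num.min u v, Num.max u v]%classic
    (fun u => c i (iter n f (s j u))) u v w (@segment_connected _ _ _)
    (continuous_subspaceT (@continuous_edge_map i j n)).
- by rewrite /= in_itv /= ge_min lexx le_max lexx.
- by rewrite /= in_itv /= ge_min lexx orbT le_max lexx orbT.
- lra.
- lra.
rewrite /= in_itv /= => /andP[rl ru] rw; exists r => //.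
rewrite !lt_neqAle rl ru !andbT; apply/andP; split; apply/eqP.
  by rewrite minEle; case: ifP => _ rE; move: ua vb; rewrite rE rw; lra.
by rewrite maxEle; case: ifP => _ rE; move: ua vb; rewrite -rE rw; lra.
Qed.

Definition subinterval (J' J : R * R) : Prop := J.1 <= J'.1 /\ J'.2 <= J.2.

(* If an arc whose [n]-th image lies in [[a, b]] is stretched across [[a, b]] at
   time [n + q], then so is a part of [[a, b]] by [f^q], which has a fixed point
   there by the intermediate value theorem. *)
Lemma periodic_or_uncrossed i j (J : R * R) (a b : R) :
  0 < a -> a < b -> b < 1 -> J.1 < J.2 ->
  exists J', [/\ J'.1 < J'.2, subinterval J' J &
    (exists2 q, (0 < q)%N & periodic_between i q a b) \/
    forall n, ~ crosses (fun u => c i (iter n f (s j u))) J' a b].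
Proof.
move=> a0 ab b1 J12.
have JJ : subinterval J J by split.
have [per|nper] := pselect (exists2 q, (0 < q)%N & periodic_between i q a b).
  by exists J; split => //; left.
have [[n [u [v [uJ vJ ua vb]]]]|nc] := pselect (exists n,
    crosses (fun u => c i (iter n f (s j u))) J a b); last first.
  by exists J; split => //; right => n h; apply: nc; exists n.
(* Aim at the midpoint, so that both ends of [[a, b]] are [(b - a) / 2] away from the image of
   [r]. *)
have [|r rab /andP[rl ru]] := edge_map_between (w := (a + b) / 2) _ ua vb; first lra.
have [d d0 dP] : exists2 d : R, 0 < d & forall x, `|r - x| < d ->
    forall k, (k <= n)%N ->
    `|c i (iter k f (s j r)) - c i (iter k f (s j x))| < (b - a) / 2.
  have : \forall x \near r, forall k : 'I_n.+1,
      `|c i (iter k f (s j r)) - c i (iter k f (s j x))| < (b - a) / 2.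
    apply: (@filter_forall _ _ (fun (k : 'I_n.+1) x =>
      `|c i (iter k f (s j r)) - c i (iter k f (s j x))| < (b - a) / 2) (nbhs r) _) => k.
    have : 0 < (b - a) / 2 by lra.
    by move/cvgrPdist_lt : (@continuous_edge_map i j k r); apply.
  move=> /nbhs_ballP[d /= d0 dP]; exists d => // x rx k kn.
  by have /(_ (Ordinal (kn : (k < n.+1)%N))) := dP x rx.
have Jr : J.1 < r < J.2.
  have : J.1 <= Num.min u v by rewrite le_min; lra.
  have : Num.max u v <= J.2 by rewrite ge_max; lra.
  lra.
(* [d / 2] keeps the closed interval around [r] inside the open ball of radius [d]; the other bounds
   keep it inside [J]. *)
pose d' := Num.min (d / 2) (Num.min (r - J.1) (J.2 - r)).
have d'0 : 0 < d' by rewrite !lt_min; lra.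
have [d'1 d'2 d'3] : [/\ d' <= d / 2, d' <= r - J.1 & d' <= J.2 - r].
  by rewrite !ge_min !lexx !orbT.
exists (r - d', r + d'); split; [by rewrite /=; lra|by split => /=; lra|].
right => n' [u' [v' [/= u'J v'J u'a v'b]]].
have near_r x : r - d' <= x <= r + d' -> `|r - x| < d.
  by move=> ?; rewrite ltr_norml; lra.
have [n'n|nn'] := leqP n' n.
  (* Up to time [n] the images of two points of the interval differ by less than [b - a], too little
     for a crossing. *)
  have := dP _ (near_r _ u'J) _ n'n; have := dP _ (near_r _ v'J) _ n'n.
  by rewrite !ltr_norml; lra.
apply: nper; exists (n' - n)%N; first by rewrite subn_gt0.
pose q := (n' - n)%N.
have n'E : n' = (q + n)%N by rewrite subnK// ltnW.
(* The coordinate at time [n]. It stays in [[a, b]], inside the open edge [i], so the later motion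
   is that of [f^q] on this edge. *)
pose h x := c i (iter n f (s j x)).
have hP x : r - d' <= x <= r + d' ->
    a <= h x <= b /\ c i (iter n' f (s j x)) = c i (iter q f (s i (h x))).
  move=> xJ; have := dP _ (near_r _ xJ) _ (leqnn n).
  rewrite rab -/(h x) ltr_norml => xab; split; first lra.
  by rewrite n'E iterD /h cK// -/(h x); lra.
have [hu' u'E] := hP _ u'J; have [hv' v'E] := hP _ v'J.
rewrite u'E in u'a; rewrite v'E in v'b.
(* The crossing at time [n'] makes [psi] nonpositive at [h u'] and nonnegative at [h v']. A zero in
   [[a, b]] gives a fixed point of [f^q], as coordinates inside [(0, 1)] determine the point. *)
pose psi x := c i (iter q f (s i x)) - x.
have cpsi : continuous psi.
  by move=> x; apply: cvgB; [exact: continuous_edge_map|exact: cvg_id].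
have := @connected_ivt _ R `[a, b]%classic psi (h u') (h v') 0
  (@segment_connected _ _ _) (continuous_subspaceT cpsi).
rewrite /= !in_itv /= => /(_ hu' hv')[||z]; [rewrite /psi; lra..|].
rewrite in_itv /= => zab /eqP; rewrite subr_eq0 => /eqP zE.
exists (s i z); last by rewrite sK; lra.
by rewrite -{2}zE cK// zE; lra.
Qed.

(** * Tame intervals and pinned lower ends *)

Hypothesis cT : compact [set: T].

Local Notation crosses_grid i j n J m k :=
  (crosses (fun u => c i (iter n f (s j u))) J (grid R m k) (grid R m k.+1)).
Local Notation periodic_in_grid i m k q :=
  (periodic_between i q (grid R m k) (grid R m k.+1)).

(** Among the grid intervals inside [(0, 1)], the arc over [J] can be stretched only across those
    with a periodic point. *)
Definition tame_interval m j (J : R * R) : Prop :=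
  forall i (k : 'I_m), 0 < grid R m k -> grid R m k.+1 < 1 ->
    (exists2 q, (0 < q)%N & periodic_in_grid i m k q) \/
    forall n, ~ crosses_grid i j n J m k.

Lemma grid_lt m k : (k < m)%N -> grid R m k < grid R m k.+1.
Proof.
move=> km; rewrite /grid ltr_pM2r ?ltr_nat// invr_gt0 ltr0n.
exact: leq_ltn_trans km.
Qed.

Lemma tame_subinterval m j (J : R * R) : J.1 < J.2 ->
  exists J', [/\ J'.1 < J'.2, subinterval J' J & tame_interval m j J'].
Proof.
move=> J12.
have [||||J' [J'12 J'J H]] := @shrink_finite (E * 'I_m)%type _
  (fun J : R * R => J.1 < J.2) subinterval
  (fun p J => 0 < grid R m p.2 -> grid R m p.2.+1 < 1 ->
    (exists2 q, (0 < q)%N & periodic_in_grid p.1 m p.2 q) \/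
    forall n, ~ crosses_grid p.1 j n J m p.2) _ _ _ _ J J12.
- by move=> ?; split.
- move=> y x z [? ?] [? ?]; split; lra.
- move=> p x y [yx1 yx2] H a0 b1; have [|nc] := H a0 b1; first by left.
  right => n [u [v [uy vy ? ?]]]; apply: (nc n).
  by exists u, v; split => //; lra.
- move=> [i k] x x12 /=.
  have [a0|] := boolP (0 < grid R m k); last by exists x; split => //; split.
  have [b1|] := boolP (grid R m k.+1 < 1); last by exists x; split => //; split.
  have [y [y12 yx H]] := periodic_or_uncrossed i j a0 (grid_lt (ltn_ord k)) b1 x12.
  by exists y; split.
- by exists J'; split => // i k; exact: (H (i, k)).
Qed.

(* The last clause makes the arc between the lower ends of two members of [V]
   meet both of them. *)
Definition pinned m j (V : set (subcontinuum T)) : Prop :=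
  (forall B B', V B -> V B' -> min_on (c j) B = min_on (c j) B') \/
  exists J, [/\ 0 < J.1, J.2 < 1, tame_interval m j J,
    forall B, V B -> J.1 <= min_on (c j) B <= J.2 &
    forall B B', V B -> V B' -> exists2 x, x \In B' & min_on (c j) B <= c j x].

(** Adds the arc of edge [j] between the coordinate [u] and the lower end of [B]; for [u] slightly
    below that end this is a small perturbation of [B]. *)
Definition extend_down j (B : set T) (u : R) : set T :=
  B `|` s j @` `[u, min_on (c j) B]%classic.

Lemma continuum_extend_down j (B : subcontinuum T) u :
  0 < min_on (c j) B < 1 -> u <= min_on (c j) B -> continuum (extend_down j B u).
Proof.
move=> m01 um; have [x Bx xm] := min_on_attained B (@cc j).
have [B0 cB connB] := subcontinuumP B.
split; first by exists x; left.
- apply: compactU => //; apply: continuous_compact; last exact: segment_compact.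
  exact: continuous_subspaceT.
- apply: connectedU => //; last first.
    apply: connected_continuous_connected; first exact: segment_connected.
    exact: continuous_subspaceT.
  exists x; split => //; exists (min_on (c j) B); first by rewrite /= in_itv /= um lexx.
  by rewrite -xm cK// xm.
Qed.

(** If a member has its lower end [mu] strictly inside the edge, it is extended down into a tame
    interval just below [mu]; [V'] asks for a lower end in that interval and a point above it.
    Otherwise all lower ends are 0 or 1, and they agree on a smaller open set. *)
Lemma pin_open m j (V : set (subcontinuum T)) : open V -> V !=set0 ->
  exists V', [/\ open V' /\ V' !=set0, V' `<=` V & pinned m j V'].
Proof.
move=> oV V0.
have [[B VB m01]|nm] := pselect (exists2 B, V B & 0 < min_on (c j) B < 1).
  set mu := min_on (c j) B in m01.
  have [x Bx xm] := min_on_attained B (@cc j).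
  have [e e0 eV] : exists2 e : R, 0 < e & ball B e `<=` V.
    by move: oV; rewrite openE => /(_ _ VB) /nbhs_ballP[e e0 eV]; exists e.
  have [d d0 dP] : exists2 d : R, 0 < d &
      forall u, `|mu - u| < d -> ball (s j mu) (e / 2) (s j u).
    have e20 : 0 < e / 2 by lra.
    have /nbhs_ballP[d d0 dP] := @sc j mu _ (nbhsx_ballx (s j mu) _ e20).
    by exists d => //= u; exact: (dP u).
  have smu : s j mu = x by rewrite /mu -xm cK// xm.
  (* [mu - d / 2] keeps the added arc close to [B], and [mu / 2] keeps the interval away from 0. *)
  pose l := Num.max (mu - d / 2) (mu / 2).
  have [l1 l2 l3] : [/\ mu - d / 2 <= l, mu / 2 <= l & l < mu].
    by rewrite /l !le_max !lexx gt_max !orbT; split=> //; lra.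
  have lmu : l < (l + mu) / 2 by lra.
  have [J [J12 [J'1 J'2] tJ]] := @tame_subinterval m j (l, (l + mu) / 2) lmu.
  rewrite /= in J'1 J'2.
  pose u := (J.1 + J.2) / 2.
  have umu : u <= mu by rewrite /u; lra.
  pose B' := Subcontinuum (continuum_extend_down m01 umu).
  have B'mu : min_on (c j) B' = u.
    have u01 : 0 <= u <= 1 by rewrite /u; lra.
    rewrite -[RHS](@sK j u)//; apply: min_on_unique; first exact: cc.
      by right; exists u => //; rewrite /= in_itv /= lexx umu.
    move=> y [By|[w + <-]]; rewrite sK//.
      by apply: (le_trans (y := mu)); [exact: umu|apply: min_on_le By; exact: cc].
    by rewrite /= in_itv /= -/mu => ?; rewrite sK; lra.
  (* The last condition makes every member reach past the lower ends of all the others. *)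
  exists (V `&` ([set B : subcontinuum T | min_on (c j) B < J.2]
    `&` [set B : subcontinuum T | J.1 < min_on (c j) B]
    `&` [set B : subcontinuum T | exists2 x, x \In B & J.2 < c j x])); split.
  - split.
      apply: openI => //; apply: openI.
        by apply: openI; [exact: open_min_on_lt|exact: open_min_on_gt].
      apply: (@open_meets _ _ (c j @^-1` [set t | J.2 < t])).
      by apply: open_comp; [move=> x1 _; exact: cc|exact: open_gt].
    exists B'; split.
      apply: eV; rewrite ballEmdist /=; apply: (@le_lt_trans _ _ (e / 2)); last lra.
      apply: subcontinuum_mdist_le; first lra.
        by move=> y By; exists y; [left|rewrite mdistxx; lra].
      move=> y [By|[w + <-]]; first by exists y => //; rewrite mdistxx; lra.
      rewrite /= in_itv /= -/mu => wm; exists x => //.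
      have := dP w; rewrite smu ballEmdist /= metric_sym; apply.
      by rewrite ger0_norm; rewrite /u in wm; lra.
    split; first by split; rewrite /mkset B'mu /u; lra.
    by exists x; [left|rewrite xm -/mu; lra].
  - by move=> ? [].
  - right; exists J; split => //; [lra|lra| |].
      by move=> ? [_ [[]]]; rewrite /mkset; lra.
    move=> B1 B2 [_ [[/ltW b1 _] _]] [_ [_ [y B2y /ltW Jy]]].
    by exists y => //; exact: le_trans b1 Jy.
have b01 B : V B -> min_on (c j) B = 0 \/ min_on (c j) B = 1.
  move=> VB; have [x Bx xm] := min_on_attained B (@cc j).
  have := cbound j x; rewrite xm => /andP[m0 m1].
  have [?|m0'] := eqVneq (min_on (c j) B) 0; first by left.
  have [?|m1'] := eqVneq (min_on (c j) B) 1; first by right.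
  by case: nm; exists B => //; rewrite !lt_neqAle m0 m1 eq_sym m0' m1'.
(* If 0 occurs as a lower end, the open condition of being below 1 leaves only 0; if not, all lower
   ends are 1. *)
have [[B VB B0]|nB] := pselect (exists2 B, V B & min_on (c j) B = 0).
  exists (V `&` [set B : subcontinuum T | min_on (c j) B < 1]); split.
  - split; first by apply: openI => //; exact: open_min_on_lt.
    by exists B; split => //; rewrite /mkset B0.
  - by move=> ? [].
  - have lt1 B1 : (V `&` [set B : subcontinuum T | min_on (c j) B < 1]) B1 ->
        min_on (c j) B1 = 0.
      by move=> [/b01[->//|h]]; rewrite /mkset h ltxx.
    by left => B1 B2 /lt1 -> /lt1 ->.
exists V; split; [by split|by []|left => B1 B2 VB1 VB2].
have [h|->] := b01 _ VB1; first by case: nB; exists B1.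
by have [h|->//] := b01 _ VB2; case: nB; exists B2.
Qed.

(** * Common periods and captured periodic points *)

Lemma iter_period q z n : iter q f z = z -> iter (q * n) f z = z.
Proof.
by move=> zq; elim: n => [|n IH]; [rewrite muln0|rewrite mulnS iterD IH].
Qed.

(** A fixed point of an iterate is fixed by all multiples of that iterate, so periods chosen one per
    grid interval can be multiplied together. *)
Lemma common_period m : exists2 q, (0 < q)%N &
  forall i (k : 'I_m), (exists2 p, (0 < p)%N & periodic_in_grid i m k p) ->
    periodic_in_grid i m k q.
Proof.
have [||||q [q0 _ H]] := @shrink_finite (E * 'I_m)%type nat
  (fun q => 0 < q)%N (fun q' q => q %| q')%N
  (fun p q => (exists2 p', (0 < p')%N & periodic_in_grid p.1 m p.2 p') ->
     periodic_in_grid p.1 m p.2 q) _ _ _ _ 1%N isT.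
- by move=> q; exact: dvdnn.
- by move=> q1 q2 q3 h1 h2; exact: dvdn_trans h2 h1.
- move=> p q1 q2 /dvdnP[d ->] H /H [z zq zI]; exists z => //.
  by rewrite mulnC iter_period.
- move=> p q q0.
  have [[p' p'0 per]|nper] := pselect
    (exists2 p', (0 < p')%N & periodic_in_grid p.1 m p.2 p').
    exists (p' * q)%N; rewrite muln_gt0 p'0 q0; split => //; first exact: dvdn_mull.
    by move=> _; case: per => z zp' zI; exists z => //; rewrite iter_period.
  by exists q; split => //.
- by exists q => // i k; exact: (H (i, k)).
Qed.

(** The same periodic point [z] has to lie in the [n]-th images of all members. *)
Definition captures (V : set (subcontinuum T)) i (q : nat) (a b : R) n : Prop :=
  exists z, [/\ iter q f z = z, a <= c i z <= b &
    forall B, V B -> (iter n f @` B) z].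

(** Both alternatives pass to smaller families and larger [N], so all grid intervals and residues
    can be settled in turn. *)
Definition settled (V : set (subcontinuum T)) (N : nat) i (q : nat) (a b : R)
    r : Prop :=
  (forall n, (N <= n)%N -> n = r %[mod q] -> captures V i q a b n) \/
  forall V' n, open V' -> V' !=set0 -> V' `<=` V -> n = r %[mod q] ->
    ~ captures V' i q a b n.

(** If some open subfamily captures [z] at a time [n] of the class of [r], it captures [z] at all
    later times of the class, as [f^q] fixes [z]; so pass to it and raise [N] to at least [n].
    Otherwise the second alternative holds already. *)
Lemma settle m q (V : set (subcontinuum T)) : (0 < q)%N -> open V -> V !=set0 ->
  exists V' N, [/\ open V' /\ V' !=set0, V' `<=` V &
    forall i (k : 'I_m) r, settled V' N i q (grid R m k) (grid R m k.+1) r].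
Proof.
move=> q0 oV V0.
have [||||[V' N] [GV [/= VV _] H]] := @shrink_finite (E * 'I_m * 'I_q)%type
  (set (subcontinuum T) * nat)%type
  (fun p => open p.1 /\ p.1 !=set0)
  (fun p' p => p'.1 `<=` p.1 /\ (p.2 <= p'.2)%N)
  (fun t p => settled p.1 p.2 t.1.1 q (grid R m t.1.2) (grid R m t.1.2.+1) t.2)
  _ _ _ _ (V, 0%N) (conj oV V0).
- by move=> p; split.
- move=> y x z [xy1 xy2] [yz1 yz2]; split; last exact: leq_trans xy2.
  exact: subset_trans yz1.
- move=> t [V1 N1] [V2 N2] /= [V21 N12] [H|H]; [left|right].
    move=> n N2n nt; have [z [zq zI zV]] := H n (leq_trans N12 N2n) nt.
    by exists z; split => // B /V21; exact: zV.
  by move=> V3 n oV3 V30 V32; apply: H => //; exact: subset_trans V21.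
- move=> [[i k] r] [V1 N1] /= [oV1 V10].
  have [[V2 [n [oV2 V20 V21 nr [z [zq zI zV]]]]]|nc] := pselect (exists V2 n,
    [/\ open V2, V2 !=set0, V2 `<=` V1, n = r %[mod q] &
        captures V2 i q (grid R m k) (grid R m k.+1) n]).
    exists (V2, maxn N1 n); split => //=; first by split => //; exact: leq_maxl.
    left => n'; rewrite geq_max => /andP[_ nn'] n'r; exists z; split => // B /zV.
    move=> [x Bx xz]; exists x => //.
    have /eqP : n' = n %[mod q] by rewrite n'r nr.
    rewrite (eqn_mod_dvd _ nn') => /dvdnP[d dE].
    by rewrite -(subnK nn') iterD xz dE mulnC iter_period.
  exists (V1, N1); split; [by split|by split|]; right => V2 n oV2 V20 V21 nr cap.
  by apply: nc; exists V2, n.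
- exists V', N; split => // i k r.
  have [G|G] := H (i, k, Ordinal (ltn_pmod r q0)); rewrite /= in G; [left|right].
    by move=> n Nn nr; apply: G => //; rewrite modn_mod.
  by move=> V2 n oV2 V20 V2V nr; apply: G => //; rewrite modn_mod.
Qed.

(** * Uniform stability on small open sets *)

(** Finitely many iterates share a modulus of continuity [d], and two members of a ball of radius
    [d / 2] are within [d] of each other. *)
Lemma iterates_near_finite (V : set (subcontinuum T)) (N : nat) (e : R) :
  0 < e -> open V -> V !=set0 ->
  exists V', [/\ open V' /\ V' !=set0, V' `<=` V &
    forall B B' n, V' B -> V' B' -> (n < N)%N -> forall x, x \In B' ->
      exists2 y, y \In B & mdist (iter n f x) (iter n f y) < e].
Proof.
move=> e0 oV [B0 VB0].
have [||||d [/= d0 _ H]] := @shrink_finite 'I_N R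
  (fun d => 0 < d) (fun d' d => d' <= d)
  (fun n d => forall x y, mdist x y < d -> mdist (iter n f x) (iter n f y) < e)
  _ _ _ _ 1 ltr01.
- by move=> ?; exact: lexx.
- by move=> y x z; exact: le_trans.
- by move=> n d d' dd' H x y xy; apply: H; exact: lt_le_trans dd'.
- move=> n d d0.
  have [d' d'0 H] := compact_uniform_continuity cT (@continuous_iter _ _ f n cf) e0.
  exists (Num.min d d'); split; [by rewrite lt_min d0|by rewrite ge_min lexx|].
  move=> x y; rewrite lt_min => /andP[_ xy].
  by have := H x y Logic.I; rewrite !ballEmdist; apply.
- exists (V `&` (ball B0 (d / 2))^°); split.
  + split; first by apply: openI => //; exact: open_interior.
    exists B0; split => //; apply: nbhsx_ballx; lra.
  + by move=> ? [].
  + move=> B B' n [_ /interior_subset B0B] [_ /interior_subset B0B'] nN x B'x.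
    have B'B : ball B' d B.
      by rewrite (splitr d); apply: ball_triangle B0B; exact: ball_sym.
    have [y By xy] := subcontinuum_ballP B'B B'x; exists y => //.
    exact: (H (Ordinal nN)).
Qed.

(** The order of shrinking matters: pin all edges for the grid dictated by [e], settle for a common
    period, then control the times before the resulting [N]. From [N] on, a point of [f^n(B')] far
    from [f^n(B)] would force a crossing that contradicts being settled. *)
Lemma uniformly_stable_open (V : set (subcontinuum T)) (e : R) :
  0 < e -> open V -> V !=set0 ->
  exists V', [/\ open V' /\ V' !=set0, V' `<=` V &
    forall B B' n, V' B -> V' B' -> forall x, x \In B' ->
      exists2 y, y \In B & mdist (iter n f x) (iter n f y) < e].
Proof.
move=> e0 oV V0.
have [_ _ _ _ sep] := cs; have [d d0 dP] := sep e e0.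
(* Grid spacing below [d / 2]: every coordinate gap of length [d] contains a whole grid interval. *)
pose m := (Num.truncn (2 / d)).+1.
have dm : 2 / d < m%:R by exact: truncnS_gt.
have [||||V1 [[oV1 V10] V1V pin]] := @shrink_finite E (set (subcontinuum T))
  (fun V => open V /\ V !=set0) (fun V' V => V' `<=` V) (fun j V => pinned m j V)
  _ _ _ _ V (conj oV V0).
- by move=> ?.
- by move=> y x z; exact: subset_trans.
- move=> j V1 V2 V21 [H|[J [J1 J2 tJ mJ mm]]]; [left|right].
    by move=> B B' /V21 VB /V21; exact: H.
  by exists J; split => // [B /V21/mJ|B B' /V21 VB /V21 VB'] //; exact: mm.
- by move=> j V1 [oV1 V10]; exact: pin_open.
have [q q0 qP] := common_period m.
have [V2 [N [[oV2 V20] V21 set2]]] := settle m q0 oV1 V10.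
have [V3 [GV3 V32 near3]] := iterates_near_finite N e0 oV2 V20.
exists V3; split => //; first exact: subset_trans V32 (subset_trans V21 V1V).
move=> B B' n V3B V3B' x B'x.
have [nN|Nn] := ltnP n N; first exact: (near3 _ _ n V3B V3B' nN).
apply: contrapT => far.
have [B0 _ connB] := subcontinuumP B; have [B'0 _ connB'] := subcontinuumP B'.
have far' y : y \In B -> e <= mdist (iter n f x) (iter n f y).
  by move=> By; rewrite leNgt; apply/negP => xy; apply: far; exists y.
(* Separation at time [n]: some coordinate puts [f^n(x)] at least [d] below the whole connected set
   [f^n(B)]. *)
have [i ci] : exists i, forall y, y \In B ->
    c i (iter n f x) + d <= c i (iter n f y).
  have [||i|i iP] := dP (iter n f @` B) (iter n f x).
  - by case: B0 => b Bb; exists (iter n f b), b.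
  - apply: connected_continuous_connected => //.
    by apply: continuous_subspaceT; exact: continuous_iter.
  - by move=> [b Bb <-]; exact: far'.
  by exists i => y By; apply: iP; exists y.
(* Separation at time 0: [x] is off the closed set [B], so on some edge it lies strictly below the
   lower end of [B]. *)
have [j cj] : exists j, c j x < min_on (c j) B.
  have clB : closed B.
    by apply: compact_closed; [exact: metric_hausdorff|case: (subcontinuumP B)].
  have nBx : ~ x \In B by move=> /ci; lra.
  have /nbhs_ballP[r /= r0 rB] : nbhs x (~` (B : set T)).
    by apply: open_nbhs_nbhs; split => //; exact: closed_openC.
  have [h h0 hP] := sep r r0.
  have [|j jP] := hP B x B0 connB.
    by move=> y By; rewrite leNgt; apply/negP => xy; apply: (rB y) By; rewrite ballEmdist.
  exists j; have [y By <-] := min_on_attained B (@cc j).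
  by have := jP y By; lra.
have [V1B V1B'] : V1 B /\ V1 B' by split; apply: V21; exact: V32.
have B'j : min_on (c j) B' <= c j x by exact: min_on_le.
have [/(_ _ _ V1B V1B')|[J [J1 J2 tJ mJ mm]]] := pin j; first lra.
have := mJ _ V1B; have := mJ _ V1B'; set w := min_on (c j) B in cj *.
move=> mB' mB.
have [y By yw] := min_on_attained B (@cc j); rewrite -/w in yw.
have swy : s j w = y by rewrite -yw cK // yw; lra.
have sxx : s j (c j x) = x by rewrite cK //; lra.
(* The lowest point [y] of [B] on edge [j] is also in [B']: from [x], which is below, [B'] reaches
   coordinate [w] or beyond, and inside the edge only [y] has coordinate [w]. *)
have B'y : y \In B'.
  have [x' B'x' wx'] := mm _ _ V1B V1B'.
  have [z B'z zw] := connected_ivt (v := w) connB' (continuous_subspaceT (@cc j))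
    B'x B'x' (ltW cj) wx'.
  by rewrite -swy -zw cK // zw; lra.
have [x0 x1] := andP (cbound i (iter n f x)).
have [y0 y1] := andP (cbound i (iter n f y)).
have xy : c i (iter n f x) + d <= c i (iter n f y) by exact: ci.
have [|k [xk kk kd]] := grid_between x0 d0 _ dm; first lra.
(* [f^n] stretches an arc of [B'] across [[a, b]], so all continua near [B']
   capture a periodic point at time [n]; since [V2] is settled, so does [B],
   whose [n]-th image misses [[a, b]]. *)
set a := grid R m k in xk kk; set b := grid R m k.+1 in kk kd.
(* [c j x] and [w] both lie in [J] and give a crossing at time [n], so tameness leaves only the
   periodic alternative. *)
have per : periodic_in_grid i m k q.
  apply: qP; case: (tJ i k); rewrite -?/a -?/b; [lra|lra|by []|].
  move=> /(_ n) []; exists (c j x), w; rewrite sxx swy.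
  by split; rewrite -?/a -?/b; lra.
(* Continua whose [n]-th image reaches below [a] and above [b]; being connected, this image contains
   the periodic point. *)
pose W := [set B : subcontinuum T | exists2 x, x \In B & c i (iter n f x) < a]
    `&` [set B : subcontinuum T | exists2 x, x \In B & b < c i (iter n f x)].
have cin : continuous (fun x => c i (iter n f x)).
  by move=> z; apply: continuous_comp; [exact: continuous_iter|exact: cc].
have oW : open W.
  apply: openI.
    apply: (open_meets (O := (fun x => c i (iter n f x)) @^-1` [set t | t < a])).
    by apply: open_comp; [move=> ? _; exact: cin|exact: open_lt].
  apply: (open_meets (O := (fun x => c i (iter n f x)) @^-1` [set t | b < t])).
  by apply: open_comp; [move=> ? _; exact: cin|exact: open_gt].
case: (set2 i k n) => [/(_ n Nn erefl)|].
  move=> [z [_ zI /(_ _ (V32 _ V3B))[b' Bb' b'z]]].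
  by have := ci _ Bb'; rewrite b'z; rewrite -/a -/b in zI; lra.
move=> /(_ (V2 `&` W) n); apply.
- exact: openI.
- exists B'; split; first exact: V32.
  by split; [exists x|exists y => //; lra].
- by move=> ? [].
- by [].
case: per => z zq zI; exists z; split => // B2 [_ [[u B2u ua] [v B2v vb]]].
have [_ _ connB2] := subcontinuumP B2.
rewrite -/a -/b in zI.
have [||t B2t tz] := connected_ivt (v := c i z) connB2 (continuous_subspaceT cin) B2u B2v.
- lra.
- lra.
exists t => //; have cz : 0 < c i z < 1 by lra.
by rewrite -(cK cz) -tz cK// tz.
Qed.

(** The [k]-th open set is the union of all open families whose iterates stay within [1 / (k + 1)]
    of each other. Uniform stability makes it dense, and a continuum in all of them is an
    equicontinuity point. *)
Theorem edge_coordinates_almost_equicontinuous :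
  almost_equicontinuous (induced_map cf).
Proof.
pose stable (e : R) (V : set (subcontinuum T)) := forall B B' n, V B -> V B' ->
  mdist (iter n (induced_map cf) B) (iter n (induced_map cf) B') <= e.
exists (fun k => \bigcup_(V in [set V | open V /\ stable k.+1%:R^-1 V]) V); split.
  move=> k; split; first by apply: bigcup_open => V [].
  have k0 : 0 < k.+1%:R^-1 :> R by rewrite invr_gt0.
  move=> O O0 oO; have [V [[oV [B VB]] VO near]] := uniformly_stable_open k0 oO O0.
  exists B; split; first exact: VO.
  exists V => //; split => // B1 B2 n VB1 VB2.
  apply: subcontinuum_mdist_le => // x; rewrite !iter_induced_map => -[y yB <-].
    have [z zB yz] := near _ _ n VB2 VB1 y yB.
    by exists (iter n f z) => //; exists z.
  have [z zB yz] := near _ _ n VB1 VB2 y yB.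
  by exists (iter n f z) => //; exists z.
move=> A capA e e0.
pose k := Num.truncn e^-1.
have [V [oV stV] VA] := capA k I.
have /nbhs_ballP[d /= d0 dV] : nbhs A V by apply: open_nbhs_nbhs.
exists d => // B /dV VB n; apply: le_lt_trans (stV _ _ n VB VA) _.
by rewrite invf_plt ?posrE// truncnS_gt.
Qed.

End Dynamics.

(** * Arcs and circles *)

Lemma within_continuous_eq (X Y : topologicalType) (A : set X) (g h : X -> Y) :
  (forall x, A x -> g x = h x) -> {within A, continuous g} ->
  {within A, continuous h}.
Proof. by move=> gh; apply: subspace_eq_continuous => x; rewrite inE => /gh. Qed.

(** Pulling a closed [W] back along [b] gives the image of the compact part of [K] in [W], which is
    closed. Off the image of [K], [b] takes a default value in [K]. *)
Lemma compact_continuous_inverse (X Y : topologicalType) (K : set X) (a : X -> Y) :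
  hausdorff_space Y -> K !=set0 -> compact K -> {within K, continuous a} ->
  (forall x y, K x -> K y -> a x = a y -> x = y) ->
  exists b : Y -> X, [/\ forall x, K x -> b (a x) = x, forall y, K (b y) &
    {within a @` K, continuous b}].
Proof.
move=> hY [x0 Kx0] cK ca ia.
have /choice[b bP] : forall y, exists x, K x /\ ((a @` K) y -> a x = y).
  move=> y; have [[x Kx xy]|ny] := pselect ((a @` K) y); first by exists x.
  by exists x0.
have bK x : K x -> b (a x) = x.
  by move=> Kx; have [Kb /(_ (imageP a Kx))] := bP (a x); exact: ia.
exists b; split => //; first by move=> y; have [] := bP y.
apply/continuous_closedP => W cW; apply/closed_subspaceP.
exists (a @` (K `&` W)).
  apply: compact_closed => //; apply: continuous_compact.
    by apply: (@continuous_subspaceW _ _ _ K _ _ ca) => x [].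
  exact: compact_closedI.
apply/seteqP; split=> y.
  by move=> [[x [Kx Wx] <-] _]; split; [change (W (b (a x))); rewrite bK|exists x].
move=> [Wy [x Kx xy]]; split; last by exists x.
by exists x => //; split => //; move: Wy; change (W (b y) -> W x); rewrite -xy bK.
Qed.

Lemma compact_unit_circle (R : realType) : compact (@unit_circle R).
Proof.
have cl : closed (@unit_circle R).
  have -> : @unit_circle R = (fun z => z.1 ^+ 2 + z.2 ^+ 2) @^-1` [set (1 : R)].
    by [].
  apply: closed_comp; last exact: closed_eq.
  move=> z _; apply: cvgD; rewrite expr2.
    by apply: cvgM; exact: cvg_fst.
  by apply: cvgM; exact: cvg_snd.
apply: (subclosed_compact cl (compact_setX (@segment_compact R (-1) 1)
  (@segment_compact R (-1) 1))) => -[x y].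
rewrite /unit_circle /mkset /= => xy.
by rewrite /= !in_itv /=; split; apply/andP; split; nra.
Qed.

Section Arcs.
Context (R : realType) (T : metricType R).
Implicit Types (X : set T) (a : R -> T).

Definition injective_path a : Prop :=
  continuous a /\
  forall t u, 0 <= t <= 1 -> 0 <= u <= 1 -> a t = a u -> t = u.

Definition arcwise_connected X : Prop := forall p q, X p -> X q -> p != q ->
  exists a, [/\ injective_path a, a 0 = p, a 1 = q &
                forall t, 0 <= t <= 1 -> X (a t)].

(** The upper half circle is mapped along [a] and the lower along [b]; a continuous injection of the
    compact circle is a homeomorphism onto its image. *)
Lemma circle_of_arcs a b : injective_path a -> injective_path b ->
  a 0 = b 0 -> a 1 = b 1 ->
  (forall t u, 0 <= t <= 1 -> 0 < u < 1 -> a t <> b u) ->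
  exists A : set T, homeomorphic A (@unit_circle R).
Proof.
move=> [ca ia] [cb ib] ab0 ab1 nab.
(* On either half circle this runs from 0 at [(1, 0)] to 1 at [(-1, 0)]. *)
pose h (z : R * R) : R := (1 - z.1) / 2.
have ch : continuous h.
  by move=> z; apply: cvgM; [apply: cvgB; [exact: cvg_cst|exact: cvg_fst]|exact: cvg_cst].
pose g z := if 0 <= z.2 then a (h z) else b (h z).
have circle1 z : unit_circle z -> 0 <= h z <= 1.
  by rewrite /unit_circle /h /mkset => zz; have : -1 <= z.1 <= 1; [nra|lra].
have circle_low z : unit_circle z -> z.2 < 0 -> 0 < h z < 1.
  rewrite /unit_circle /h /mkset => zz z2; have : -1 < z.1 < 1; [nra|lra].
have cg : {within @unit_circle R, continuous g}.
  have clc : closed (@unit_circle R).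
    by apply: compact_closed; [exact: norm_hausdorff|exact: compact_unit_circle].
  have clU : closed [set z : R * R | 0 <= z.2].
    by apply: (@closed_comp _ _ snd [set t : R | 0 <= t]);
      [move=> z _; exact: cvg_snd|exact: closed_ge].
  have clL : closed [set z : R * R | z.2 <= 0].
    by apply: (@closed_comp _ _ snd [set t : R | t <= 0]);
      [move=> z _; exact: cvg_snd|exact: closed_le].
  have -> : @unit_circle R = (@unit_circle R `&` [set z | 0 <= z.2]) `|`
      (@unit_circle R `&` [set z | z.2 <= 0]).
    apply/seteqP; split => [z zc|z [[]|[]]//].
    by have /orP[] := le_total 0 z.2; [left|right].
  apply: withinU_continuous; [exact: closedI|exact: closedI| |].
    apply: (within_continuous_eq (g := a \o h)) => [z [_ z2]|].
      by rewrite /g ifT.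
    apply: continuous_subspaceT => z.
    by apply: continuous_comp; [exact: ch|exact: ca].
  apply: (within_continuous_eq (g := b \o h)) => [z [zc]|].
    rewrite /mkset => z2; rewrite /g; case: ifP => // z2'.
    have z20 : z.2 = 0 by lra.
    move: zc; rewrite /unit_circle /mkset z20 expr0n addr0 => /eqP.
    by rewrite sqrf_eq1 /= /h => /orP[] /eqP ->; rewrite ?subrr ?mul0r// opprK divff.
  apply: continuous_subspaceT => z.
  by apply: continuous_comp; [exact: ch|exact: cb].
have ig z z' : unit_circle z -> unit_circle z' -> g z = g z' -> z = z'.
  (* On a closed half circle the first coordinate determines the point. *)
  have same_sheet : unit_circle z -> unit_circle z' -> h z = h z' ->
      0 <= z.2 * z'.2 -> z = z'.
    rewrite /unit_circle /mkset /h => zc zc' hz zz'.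
    have z1 : z.1 = z'.1 by lra.
    have z2 : z.2 = z'.2.
      have : (z.2 - z'.2) * (z.2 + z'.2) = 0 by rewrite z1 in zc; lra.
      by move/eqP; rewrite mulf_eq0 => /orP[] /eqP; nra.
    by rewrite [z]surjective_pairing z1 z2 -surjective_pairing.
  move=> zc zc'; have h1 := circle1 _ zc; have h1' := circle1 _ zc'.
  rewrite /g; case: leP => z2; case: leP => z2'.
  - move=> /(ia _ _ h1 h1') hz; apply: same_sheet => //; nra.
  - by move=> /nab -/(_ h1 (circle_low _ zc' z2')).
  - by move=> /esym/nab -/(_ h1' (circle_low _ zc z2)).
  - move=> /(ib _ _ h1 h1') hz; apply: same_sheet => //; nra.
have c0 : @unit_circle R !=set0.
  by exists (1, 0); rewrite /unit_circle /mkset expr0n addr0 expr1n.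
have [f [fK fc cf]] := compact_continuous_inverse (@metric_hausdorff _ T) c0
  (@compact_unit_circle R) cg ig.
exists (g @` @unit_circle R), f, g; split; [|..|by split].
- by move=> _ [z zc <-]; exact: fc.
- by move=> z zc; exists z.
- by move=> _ [z zc <-]; rewrite fK.
- exact: fK.
Qed.

End Arcs.

(** Without a common point in [B], the part of [B] in [X] would be open and closed in [B], hence all
    of [B]. *)
Lemma connected_closed_cover (T : topologicalType) (B X Y : set T) :
  connected B -> closed X -> closed Y -> B `<=` X `|` Y ->
  B `&` X !=set0 -> B `&` Y !=set0 -> exists2 z, B z & X z /\ Y z.
Proof.
move=> cB clX clY BXY BX [y [By Yy]]; apply: contrapT => nXY.
have BXE : B `&` X = B `&` ~` Y.
  apply/seteqP; split=> z [Bz Xz]; split => //.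
    by move=> Yz; apply: nXY; exists z.
  by have [] := BXY z Bz.
have BXB : B `&` X = B.
  by apply: cB => //; [exists (~` Y) => //; exact: closed_openC|exists X].
have [_ Xy] : (B `&` X) y by rewrite BXB.
by apply: nXY; exists y.
Qed.

(** * Adding an arc *)

Section Growth.
Context (R : realType) (T : metricType R).
Implicit Types (X W : set T) (a : R -> T).

(* [W] is a set of vertices. Edge interiors avoid it, so that an arc attached at
   a point of [W] leaves [0 < c i x < 1 -> s i (c i x) = x] true. *)
Definition coordinates_on W X (E : finType) (c : E -> T -> R) (s : E -> R -> T)
    : Prop :=
  [/\ forall i, {within X, continuous (c i)} /\ continuous (s i),
      forall i x, X x -> 0 <= c i x <= 1,
      forall i u, 0 <= u <= 1 ->
        [/\ X (s i u), c i (s i u) = u & 0 < u < 1 -> ~ W (s i u)],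
      forall i x, X x -> 0 < c i x < 1 -> s i (c i x) = x &
      forall e : R, 0 < e -> exists2 d : R, 0 < d &
        forall (B : set T) x, B !=set0 -> connected B -> B `<=` X -> X x ->
          (forall i, exists2 y, B y & `|c i x - c i y| < d) ->
          exists2 y, B y & mdist x y < e].

Definition has_coordinates W X : Prop :=
  exists (E : finType) (c : E -> T -> R) (s : E -> R -> T), coordinates_on W X c s.

Lemma has_coordinates1 W x : has_coordinates W [set x].
Proof.
exists void, (fun _ _ => 0), (fun _ _ => x); split => // e e0.
exists 1 => // B y [z Bz] _ /(_ z Bz) zx yx _; exists z => //.
by rewrite (zx : z = x) (yx : y = x) mdistxx.
Qed.

Lemma arc_uniform a (e : R) : continuous a -> 0 < e -> exists2 d : R, 0 < d &
  forall u v, 0 <= u <= 1 -> `|u - v| < d -> mdist (a u) (a v) < e.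
Proof.
move=> ca e0.
have [d d0 H] := compact_uniform_continuity (@segment_compact R 0 1) ca e0.
by exists d => // u v u01 uv; have := H u v; rewrite ballEmdist; apply.
Qed.

(** [X] and the arc meet only at [a 0]. Old coordinates continue along the arc with their value at
    [a 0]; the new one is the arc parameter, set to 0 on [X]. *)
Lemma add_arc_coordinates W X a :
  closed X -> injective_path a -> X (a 0) -> W (a 0) ->
  (forall u, 0 < u <= 1 -> ~ X (a u)) -> (forall u, 0 < u < 1 -> ~ W (a u)) ->
  has_coordinates W X -> has_coordinates W (X `|` a @` `[0, 1]%classic).
Proof.
move=> clX [ca ia] X0 W0 aX aW [E [c [s [csc c01 csK scK sep]]]].
pose Y := a @` `[(0 : R), 1]%classic.
have I01 (u : R) : `[(0 : R), 1]%classic u <-> 0 <= u <= 1.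
  by rewrite /= in_itv.
have clY : closed Y.
  apply: compact_closed; first exact: metric_hausdorff.
  apply: continuous_compact; last exact: segment_compact.
  exact: continuous_subspaceT.
have [||l [la l01 cl]] := @compact_continuous_inverse R T `[0, 1]%classic a
    (@metric_hausdorff _ T) _ (@segment_compact R 0 1) (continuous_subspaceT ca).
- by exists 0; apply/I01; rewrite lexx ler01.
- by move=> u v /I01 u01 /I01 v01; exact: ia.
have {}la u : 0 <= u <= 1 -> l (a u) = u by move=> /I01; exact: la.
have {}l01 y : 0 <= l y <= 1 by apply: (I01 _).1; exact: l01.
have Ya u : 0 <= u <= 1 -> Y (a u) by move=> /I01 ?; exists u.
have Yl y : Y y -> a (l y) = y by move=> [u /I01 u01 <-]; rewrite la.
have Y0 : Y (a 0) by apply: Ya; rewrite lexx ler01.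
have l0 : l (a 0) = 0 by rewrite la// lexx ler01.
have XY x : X x -> Y x -> x = a 0.
  move=> Xx [u /I01 u01 ux]; have [u0|u0] := eqVneq u 0; first by rewrite -ux u0.
  case: (aX u); last by rewrite ux.
  by move/andP: u01 => [u1 ->]; rewrite lt_neqAle eq_sym u0 u1.
pose c' o x := if o is Some i then if x \in Y then c i (a 0) else c i x
  else if x \in Y then l x else 0.
pose s' o := if o is Some i then s i else a.
have cX i x : X x -> c' (Some i) x = c i x.
  by move=> Xx /=; case: ifPn => // /set_mem Yx; rewrite (XY _ Xx Yx).
have cNX x : X x -> c' None x = 0.
  by move=> Xx /=; case: ifPn => // /set_mem Yx; rewrite (XY _ Xx Yx).
have cY i x : Y x -> c' (Some i) x = c i (a 0).
  by move=> Yx /=; rewrite mem_set.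
have cNY x : Y x -> c' None x = l x.
  by move=> Yx /=; rewrite mem_set.
(* The retraction onto [X] collapsing the arc to [a 0]; the old coordinates factor through it. *)
pose r x := if x \in Y then a 0 else x.
have rX x : X x -> r x = x.
  by move=> Xx; rewrite /r; case: ifPn => // /set_mem Yx; rewrite (XY _ Xx Yx).
have rY x : Y x -> r x = a 0 by move=> Yx; rewrite /r mem_set.
have cr : {within X `|` Y, continuous r}.
  apply: withinU_continuous => //.
    apply: (within_continuous_eq (g := id)); first by move=> x /rX.
    by apply: continuous_subspaceT => x; exact: cvg_id.
  apply: (within_continuous_eq (g := (fun=> a 0))); first by move=> x /rY.
  by apply: continuous_subspaceT => x; exact: cvg_cst.
exists (option E), c', s'; split.
- move=> [i|]; split.
  + apply: withinU_continuous => //.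
      by apply: within_continuous_eq (csc i).1 => x /cX.
    apply: (within_continuous_eq (g := (fun=> c i (a 0)))); first by move=> x /cY.
    by apply: continuous_subspaceT => x; exact: cvg_cst.
  + by have [] := csc i.
  + apply: withinU_continuous => //.
      apply: (within_continuous_eq (g := (fun=> 0))); first by move=> x /cNX.
      by apply: continuous_subspaceT => x; exact: cvg_cst.
    by apply: within_continuous_eq cl => x /cNY.
  + exact: ca.
- move=> [i|] x [Xx|Yx].
  + by rewrite cX//; exact: c01.
  + by rewrite cY//; exact: c01.
  + by rewrite cNX// lexx ler01.
  + by rewrite cNY.
- move=> [i|] u u01.
  + by have [Xs cs Ws] := csK i u u01; rewrite cX//; split => //; left.
  + by rewrite cNY/= ?la//; [split => //; [right; exact: Ya|exact: aW]|exact: Ya].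
- move=> [i|] x [Xx|Yx].
  + by rewrite cX// => /scK; exact.
  (* An old coordinate inside [(0, 1)] on the arc would put the vertex [a 0] in the interior of edge
     [i]. *)
  + rewrite cY// => c0; have /(_ c0) sc0 := scK i _ X0.
    have [_ _ /(_ c0)] := csK i (c i (a 0)) (c01 i _ X0).
    by rewrite sc0.
  + by rewrite cNX// ltxx.
  + by rewrite cNY// => _; exact: Yl.
move=> e e0; have e20 : 0 < e / 2 by lra.
have [d d0 dP] := sep _ e20; have [d' d'0 d'P] := arc_uniform ca e20.
exists (Num.min d d'); first by rewrite lt_min d0.
move=> B x B0 cB BXY XYx near.
have c'r i y : (X `|` Y) y -> c' (Some i) y = c i (r y).
  by move=> [Xy|Yy]; [rewrite rX// cX|rewrite rY// cY].
have Xr y : (X `|` Y) y -> X (r y) by move=> [Xy|Yy]; [rewrite rX|rewrite rY].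
(* [y1] is close to [x] after retraction, and [y2] below is close in the arc parameter; the case
   analysis combines the two. *)
have [y1 By1 ry1] : exists2 y, B y & mdist (r x) (r y) < e / 2.
  have [||||i|_ [y By <-] xy] := dP (r @` B) (r x).
  - by case: B0 => b Bb; exists (r b), b.
  - apply: connected_continuous_connected => //.
    exact: (@continuous_subspaceW _ _ _ (X `|` Y)).
  - by move=> _ [y By <-]; apply: Xr; exact: BXY.
  - exact: Xr XYx.
  - have [y By xy] := near (Some i); exists (r y); first by exists y.
    by move: xy; rewrite !c'r//; [rewrite lt_min => /andP[]|exact: BXY].
  - by exists y.
have [y2 By2] := near None; rewrite lt_min => /andP[_ y2d].
(* A connected set meeting both [X] and the arc passes through [a 0]. *)
have cross y y' : B y -> B y' -> X y -> Y y' -> B (a 0).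
  move=> By By' Xy Yy'.
  have [||z Bz [Xz Yz]] := connected_closed_cover cB clX clY BXY.
  - by exists y.
  - by exists y'.
  - by rewrite -(XY z Xz Yz).
have tri z z' : mdist x z < e / 2 -> mdist z z' < e / 2 -> mdist x z' < e.
  by move=> h1 h2; apply: le_lt_trans (metric_triangle _ z _) _; lra.
have y2X : X y2 -> mdist (r x) x < e / 2 -> exists2 y, B y & mdist x y < e.
  move=> Xy2 rxx; rewrite metric_sym in rxx.
  case: (BXY _ By1) => [Xy1|Yy1].
    by exists y1 => //; apply: tri rxx _; rewrite -[y1 in mdist _ y1]rX.
  have B0' := cross _ _ By2 By1 Xy2 Yy1.
  exists (a 0) => //; apply: tri rxx _; by rewrite -(rY _ Yy1).
case: XYx => [Xx|Yx].
  case: (BXY _ By2) => [Xy2|Yy2].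
    by apply: y2X => //; rewrite rX// mdistxx.
  move: y2d; rewrite cNX// cNY// => y2d.
  case: (BXY _ By1) => [Xy1|Yy1].
    exists y1 => //; apply: lt_trans (_ : _ < e / 2) _; last lra.
    by rewrite -[x]rX// -[y1 in mdist _ y1]rX.
  exists y2 => //; apply: (tri (a 0)); first by rewrite -[x]rX// -(rY _ Yy1).
  by rewrite -[y2]Yl//; apply: d'P; rewrite ?lexx ?ler01.
case: (BXY _ By2) => [Xy2|Yy2].
  apply: y2X => //; rewrite rY// -[x]Yl//; apply: d'P; rewrite ?lexx ?ler01//.
  by move: y2d; rewrite (cNX _ Xy2) (cNY _ Yx) distrC.
exists y2 => //; apply: (@lt_trans _ _ (e / 2)); last lra.
rewrite -[x]Yl// -[y2]Yl//; apply: d'P => //.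
by move: y2d; rewrite !cNY.
Qed.

Lemma subpath a (t u : R) : injective_path a -> 0 <= t <= 1 -> 0 <= u <= 1 ->
  t != u -> injective_path (fun x => a (t + x * (u - t))).
Proof.
move=> [ca ia] t01 u01 tu; split.
  move=> x.
  apply: (@continuous_comp R R T (fun x : R => t + x * (u - t)) a x); last exact: ca.
  by apply: cvgD; [exact: cvg_cst|apply: cvgM; [exact: cvg_id|exact: cvg_cst]].
move=> x y x01 y01 /ia xy; have : t + x * (u - t) = t + y * (u - t).
  by apply: xy; nra.
move=> /addrI /mulIf; apply; by rewrite subr_eq0 eq_sym.
Qed.

Lemma path_cat a b : injective_path a -> injective_path b -> a 1 = b 0 ->
  (forall t u, 0 <= t <= 1 -> 0 < u <= 1 -> a t <> b u) ->
  exists g, [/\ injective_path g, g 0 = a 0, g 1 = b 1 &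
    forall t, 0 <= t <= 1 -> exists2 u, 0 <= u <= 1 & g t = a u \/ g t = b u].
Proof.
move=> [ca ia] [cb ib] ab nab.
pose g (t : R) := if t <= 1 / 2 then a (2 * t) else b (2 * t - 1).
have gr t : 1 / 2 <= t -> g t = b (2 * t - 1).
  move=> t2; rewrite /g; case: ifP => // t2'; have -> : t = 1 / 2 by lra.
  by rewrite -[RHS]/(b _) (_ : 2 * (1 / 2) = 1) ?ab ?subrr//; lra.
have gl t : t <= 1 / 2 -> g t = a (2 * t) by rewrite /g => ->.
exists g; split.
- split.
    apply/continuous_subspace_setT.
    have -> : [set: R] = [set t | t <= 1 / 2] `|` [set t | 1 / 2 <= t].
      by apply/seteqP; split=> // t _; have /orP[] := le_total t (1 / 2); [left|right].
    apply: withinU_continuous; [exact: closed_le|exact: closed_ge| |].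
      apply: (within_continuous_eq (g := fun t : R => a (2 * t))); first by move=> t /gl.
      apply: continuous_subspaceT => t.
      apply: (@continuous_comp R R T (fun t : R => 2 * t) a t); last exact: ca.
      by apply: cvgM; [exact: cvg_cst|exact: cvg_id].
    apply: (within_continuous_eq (g := fun t : R => b (2 * t - 1))).
      by move=> t /gr.
    apply: continuous_subspaceT => t.
    apply: (@continuous_comp R R T (fun t : R => 2 * t - 1) b t); last exact: cb.
    by apply: cvgB; [apply: cvgM; [exact: cvg_cst|exact: cvg_id]|exact: cvg_cst].
  move=> t u t01 u01; rewrite /g; case: leP => t2; case: leP => u2.
  + by move=> /ia; lra.
  + by move=> /nab []; lra.
  + by move=> /esym/nab []; lra.
  + by move=> /ib; lra.
- by rewrite gl ?mulr0//; lra.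
- by rewrite gr; [congr b; lra|lra].
- move=> t t01; have [t2|t2] := lerP t (1 / 2).
    by exists (2 * t); [lra|left; exact: gl].
  by exists (2 * t - 1); [lra|right; apply: gr; lra].
Qed.

(** A point of [X] is joined to the arc through [a 0], the only common point; reversal and subarcs
    give the other cases. *)
Lemma add_arc_arcwise_connected X a : injective_path a -> X (a 0) ->
  (forall u, 0 < u <= 1 -> ~ X (a u)) ->
  arcwise_connected X -> arcwise_connected (X `|` a @` `[0, 1]%classic).
Proof.
move=> [ca ia] X0 aX arcX.
have Ya u : 0 <= u <= 1 -> (X `|` a @` `[0, 1]%classic) (a u).
  by move=> u01; right; exists u => //; rewrite /= in_itv.
have sub t u : 0 <= t <= 1 -> 0 <= u <= 1 -> t != u ->
    exists g, [/\ injective_path g, g 0 = a t, g 1 = a u &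
      forall x, 0 <= x <= 1 -> exists2 v, Num.min t u <= v <= Num.max t u & g x = a v].
  move=> t01 u01 tu; exists (fun x => a (t + x * (u - t))); split.
  - exact: subpath.
  - by rewrite mul0r addr0.
  - by rewrite mul1r addrC subrK.
  - move=> x x01; exists (t + x * (u - t)) => //.
    have /andP[x0 x1] := x01; have x1' : 0 <= 1 - x by lra.
    have [tu'|/ltW tu'] := leP t u; rewrite -subr_ge0 in tu'.
      by have := mulr_ge0 x0 tu'; have := mulr_ge0 x1' tu'; lra.
    by have := mulr_ge0 x0 tu'; have := mulr_ge0 x1' tu'; lra.
have XtoY p u : X p -> 0 < u <= 1 -> exists g, [/\ injective_path g, g 0 = p, g 1 = a u &
    forall t, 0 <= t <= 1 -> (X `|` a @` `[0, 1]%classic) (g t)].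
  move=> Xp u01.
  have [|||h [ih h0 h1 hI]] := sub 0 u; [lra|lra|by apply/eqP; lra|].
  have {}hI x : 0 <= x <= 1 -> exists2 v, 0 <= v <= u & h x = a v.
    by move=> /hI; rewrite min_l ?max_r//; lra.
  have [pE|pE] := eqVneq p (a 0).
    exists h; split => //; first by rewrite pE.
    by move=> t /hI[v v01 ->]; apply: Ya; lra.
  have [g [ig g0 g1 gX]] := arcX p (a 0) Xp X0 pE.
  have [||k [ik k0 k1 kI]] := path_cat ig ih; first by rewrite g1 h0.
    move=> t v t01 v01 gh; have [|w w0 hw] := hI v; first lra.
    have [w00|w00] := eqVneq w 0.
      have hv0 : h v = h 0 by rewrite hw h0 w00.
      have v1 : 0 <= v <= 1 by lra.
      have z1 : 0 <= (0 : R) <= 1 by rewrite lexx ler01.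
      by have := ih.2 _ _ v1 z1 hv0; lra.
    by apply: (aX w); [lra|rewrite -hw -gh; exact: gX].
  exists k; split => //; rewrite ?k0 ?k1//.
  move=> t /kI[v v01 [->|->]]; first by left; exact: gX.
  by have [w w0 ->] := hI v v01; apply: Ya; lra.
have rev g p q : injective_path g -> g 0 = p -> g 1 = q ->
    (forall t, 0 <= t <= 1 -> (X `|` a @` `[0, 1]%classic) (g t)) ->
    exists g, [/\ injective_path g, g 0 = q, g 1 = p &
    forall t, 0 <= t <= 1 -> (X `|` a @` `[0, 1]%classic) (g t)].
  move=> ig g0 g1 gX; exists (fun x => g (1 + x * (0 - 1))); split.
  - by apply: subpath; rewrite ?lexx ?ler01// oner_eq0.
  - by rewrite mul0r addr0.
  - by rewrite mul1r addrC subrK.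
  - by move=> t t01; apply: gX; lra.
have Ycases q : (X `|` a @` `[0, 1]%classic) q -> X q \/ exists2 u, 0 < u <= 1 & q = a u.
  move=> [Xq|[u]]; first by left.
  rewrite /= in_itv /= => u01 <-; have [->|u0] := eqVneq u 0; first by left.
  by right; exists u => //; rewrite lt_neqAle eq_sym u0.
move=> p q /Ycases[Xp|[t t01 ->]] /Ycases[Xq|[u u01 ->]] pq.
- have [g [ig g0 g1 gX]] := arcX p q Xp Xq pq; exists g; split => // t t01.
  by left; exact: gX.
- exact: XtoY.
- by have [g [ig g0 g1 gX]] := XtoY _ _ Xq t01; exact: rev gX.
- have [|||g [ig g0 g1 gI]] := sub t u; [lra|lra|by apply: contraNneq pq => ->|].
  exists g; split => // x /gI[v vI ->]; apply: Ya.
  have : 0 <= Num.min t u by rewrite le_min; lra.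
  have : Num.max t u <= 1 by rewrite ge_max; lra.
  lra.
Qed.

End Growth.

(** * From simplicial complexes to coordinates *)

Section Decomposition.
Context (R : realType) (T : metricType R) (I : finType) (a : I -> R -> T).

(* The constant pieces stand for the vertices of the complex. *)
Definition arc_decomposition : Prop :=
  [/\ forall i, continuous (a i),
      forall x, exists i, exists2 u, 0 <= u <= 1 & a i u = x &
      forall i, (forall u, a i u = a i 0) \/
        a i 0 <> a i 1 /\
        forall j u w, 0 < u < 1 -> 0 <= w <= 1 -> a i u = a j w ->
          i = j /\ u = w].

Hypothesis dec : arc_decomposition.
Hypothesis T0 : [set: T] !=set0.
Hypothesis connT : connected [set: T].
Hypothesis nocircle : ~ exists A : set T, homeomorphic A (@unit_circle R).

Let W : set T := [set x | exists i, x = a i 0 \/ x = a i 1].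
Let Y i : set T := a i @` `[0, 1]%classic.

(** A piece not contained in [X] can then touch [X] only at its ends. *)
Definition subcomplex (X : set T) : Prop :=
  forall i u, 0 < u < 1 -> X (a i u) -> Y i `<=` X.

Let ca i : continuous (a i). Proof. by have [] := dec. Qed.

Lemma piece_point i u : 0 <= u <= 1 -> Y i (a i u).
Proof. by move=> u01; exists u => //; rewrite /= in_itv. Qed.

Lemma constant_piece i u X : (forall u, a i u = a i 0) -> X (a i u) -> Y i `<=` X.
Proof. by move=> ai0 + _ [w _ <-]; rewrite (ai0 u) (ai0 w). Qed.

Lemma edge_injective_path i : a i 0 <> a i 1 ->
  (forall j u w, 0 < u < 1 -> 0 <= w <= 1 -> a i u = a j w -> i = j /\ u = w) ->
  injective_path (a i).
Proof.
move=> a01 inj; split=> // t u t01 u01 tu.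
have [t0|t0] := eqVneq t 0; last have [t1|t1] := eqVneq t 1; last first.
- by apply: (inj i t u _ u01 tu).2; lra.
- have [u1|u1] := eqVneq u 1; first by rewrite t1.
  have [u0|u0] := eqVneq u 0; first by case: a01; rewrite -t1 -u0 tu.
  by apply/esym; apply: (inj i u t _ t01 (esym tu)).2; lra.
- have [u0|u0] := eqVneq u 0; first by rewrite t0.
  have [u1|u1] := eqVneq u 1; first by case: a01; rewrite -t0 -u1 tu.
  by apply/esym; apply: (inj i u t _ t01 (esym tu)).2; lra.
Qed.

(** By connectedness some piece not inside [X] touches [X], necessarily at an end. Both ends in [X]
    would close a circle, so the piece can be attached as an arc leaving [X] for good. *)
Lemma grow_subcomplex X : closed X -> X !=set0 -> subcomplex X ->
  arcwise_connected X -> has_coordinates W X -> X <> setT ->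
  exists i, exists X', [/\ closed X', X `<=` X', Y i `<=` X', ~ Y i `<=` X &
    [/\ subcomplex X', arcwise_connected X' & has_coordinates W X']].
Proof.
move=> clX X0 subX arcX coX XT; have [_ cov edge] := dec.
(* [X] and the union of the pieces not inside [X] are closed and cover the connected space [T], so
   they meet. *)
have [i [u u01 Xu] nYX] : exists2 i, (exists2 u, 0 <= u <= 1 & X (a i u)) & ~ Y i `<=` X.
  apply: contrapT => none; apply: XT; apply/seteqP; split=> // x _.
  apply: contrapT => nXx.
  have [i [u u01 ux]] := cov x.
  have [||||||z _ [Xz [j nYjX [w wI wz]]]] := @connected_closed_cover _ setT X
    (\bigcup_(i in [set i | ~ Y i `<=` X]) Y i).
  - exact: connT.
  - exact: clX.
  - apply: closed_bigcup; first exact: finite_finset.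
    move=> j _; apply: compact_closed; first exact: metric_hausdorff.
    apply: continuous_compact; last exact: segment_compact.
    exact: continuous_subspaceT.
  - move=> y _; have [j [w w01 <-]] := cov y.
    have [YX|nYX] := pselect (Y j `<=` X); first by left; apply: YX; exact: piece_point.
    by right; exists j => //; exact: piece_point.
  - by rewrite setTI.
  - exists x; split => //; exists i; last by rewrite -ux; exact: piece_point.
    by move=> YX; apply: nXx; rewrite -ux; apply: YX; exact: piece_point.
  - apply: none; exists j => //; exists w; last by rewrite wz.
    by move: wI; rewrite /= in_itv.
have [ai0|[a01 inj]] := edge i.
  by case: nYX; exact: constant_piece Xu.
have nX v : 0 < v < 1 -> ~ X (a i v) by move=> v01 /(subX _ _ v01).
have nW v : 0 < v < 1 -> ~ W (a i v).
  have z1 : 0 <= (0 : R) <= 1 by rewrite lexx ler01.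
  have o1 : 0 <= (1 : R) <= 1 by rewrite lexx ler01.
  by move=> v01 [j [/(inj _ _ _ v01 z1)|/(inj _ _ _ v01 o1)]] [_]; lra.
have ipath := edge_injective_path a01 inj.
suff [b [[ib Xb0 Wb0 nXb nWb] bY]] : exists b, [/\ injective_path b, X (b 0), W (b 0),
    forall v, 0 < v <= 1 -> ~ X (b v) & forall v, 0 < v < 1 -> ~ W (b v)] /\
    b @` `[0, 1]%classic = Y i.
  exists i; exists (X `|` b @` `[0, 1]%classic); split.
  - apply: closedU => //; rewrite bY.
    apply: compact_closed; first exact: metric_hausdorff.
    apply: continuous_compact; last exact: segment_compact.
    exact: continuous_subspaceT.
  - by move=> x; left.
  - by rewrite bY => x; right.
  - exact: nYX.
  split; last first.
  - exact: add_arc_coordinates.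
  - exact: add_arc_arcwise_connected.
  rewrite bY => j v v01 [/(subX _ _ v01) YX|]; first by move=> x /YX; left.
  have [aj0|[_ injj]] := edge j.
    by move=> Yv; apply: constant_piece aj0 _; right; exact: Yv.
  move=> [w]; rewrite /= in_itv /= => w01 /esym/(injj _ _ _ v01 w01)[-> _] x Yx.
  by right.
have u_end : u = 0 \/ u = 1.
  have [->|u0] := eqVneq u 0; first by left.
  have [->|u1] := eqVneq u 1; first by right.
  have u01' : 0 < u < 1 by rewrite !lt_neqAle u1 eq_sym u0.
  by case: (nX u u01').
(* With both ends of [a i] in [X], an arc of [X] between them closes a circle. *)
have [X0i|nX0i] := pselect (X (a i 0)).
  exists (a i); split => //; split => //; first by exists i; left.
  move=> v v01; have [->|v1] := eqVneq v 1; last by apply: nX; lra.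
  move=> X1i; apply: nocircle.
  have [g [ig g0 g1 gX]] := arcX _ _ X0i X1i (introN eqP a01).
  apply: (circle_of_arcs ig ipath g0 g1) => t w t01 w01 gw.
  by apply: (nX w w01); rewrite -gw; exact: gX.
have X1i : X (a i 1) by case: u_end Xu => -> // /nX0i.
(* Only the end [a i 1] lies in [X], so the piece is run backwards. *)
exists (fun x => a i (1 + x * (0 - 1))); split; first split.
- by apply: subpath => //; rewrite ?lexx ?ler01// oner_eq0.
- by rewrite mul0r addr0.
- by rewrite mul0r addr0; exists i; right.
- move=> v v01; have [->|v1] := eqVneq v 1; first by rewrite mul1r addrC subrK.
  by apply: nX; lra.
- by move=> v v01; apply: nW; lra.
apply/seteqP; split=> [x [v vI <-]|x [v vI <-]]; move: vI; rewrite /= in_itv /= => vI.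
  by apply: piece_point; lra.
exists (1 - v); first by rewrite /= in_itv /=; lra.
by congr (a i _); lra.
Qed.

(** Starting from one vertex, each growth step lowers the number of pieces not inside [X]. *)
Lemma decomposition_has_coordinates : has_coordinates W [set: T].
Proof.
have [_ cov edge] := dec.
suff grow n X : (#|[set i | ~~ `[< Y i `<=` X >]]%SET| <= n)%N ->
    closed X -> X !=set0 -> subcomplex X -> arcwise_connected X ->
    has_coordinates W X -> has_coordinates W [set: T].
  have [x0 [i [u u01 _]]] : exists x, exists i, exists2 u, 0 <= u <= 1 & a i u = x.
    have [x _] := T0; exists x; exact: cov.
  apply: (grow #|[set j | ~~ `[< Y j `<=` [set a i 0] >]]%SET| [set a i 0]).
  - by [].
  - by apply: compact_closed; [exact: metric_hausdorff|exact: compact_set1].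
  - by exists (a i 0).
  - move=> j v v01 /=; have [aj0|[_ inj]] := edge j.
      by move=> Yv; apply: constant_piece aj0 Yv.
    by move=> /(inj _ _ _ v01); rewrite lexx ler01 => /(_ isT)[_]; lra.
  - by move=> p q -> ->; rewrite eqxx.
  - exact: has_coordinates1.
elim: n X => [|n IH] X Xn clX X0 subX arcX coX;
  (have [XE|XT] := pselect (X = setT); first by rewrite -XE);
  have [i [X' [clX' XX' YX' nYX [subX' arcX' coX']]]] :=
    grow_subcomplex clX X0 subX arcX coX XT.
  have : i \in [set i | ~~ `[< Y i `<=` X >]]%SET by rewrite inE; apply/asboolPn.
  by move: Xn; rewrite leqn0 cards_eq0 => /eqP ->; rewrite inE.
apply: (IH X') => //; last by have [x Xx] := X0; exists x; exact: XX'.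
rewrite -ltnS; apply: leq_trans Xn; apply: proper_card; apply/properP; split.
  apply/fintype.subsetP => j; rewrite !inE => /asboolPn nYjX'.
  by apply/asboolPn => YjX; apply: nYjX'; exact: subset_trans XX'.
by exists i; rewrite inE; [apply/asboolPn|rewrite negbK; apply/asboolP].
Qed.

End Decomposition.

Lemma continuous_comp_within (X Y Z : topologicalType) (B : set Y)
    (g : Y -> Z) (k : X -> Y) :
  {within B, continuous g} -> continuous k -> (forall x, B (k x)) ->
  continuous (g \o k).
Proof.
move=> /subspace_continuousP cg ck Bk x U gU.
have h : nbhs (k x) [set y | B y -> U (g y)] := cg _ (Bk x) U gU.
have : nbhs x (k @^-1` [set y | B y -> U (g y)]) := ck x _ h.
by apply: filterS => y; apply; exact: Bk.
Qed.

Section Clip.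
Context (R : realType).

(** Truncation of [u] to [[0, 1]], written with absolute values to make continuity immediate. It
    keeps edge paths inside the carrier for all real parameters. *)
Definition clip (u : R) : R := (`|u| - `|u - 1| + 1) / 2.

Lemma clip01 u : 0 <= clip u <= 1.
Proof.
by rewrite /clip; have [|] := leP 0 u => u0; have [|] := leP 0 (u - 1) => u1;
  rewrite ?(ger0_norm u0) ?(ltr0_norm u0) ?(ger0_norm u1) ?(ltr0_norm u1); lra.
Qed.

Lemma clip_id u : 0 <= u <= 1 -> clip u = u.
Proof. by move=> u01; rewrite /clip ger0_norm ?ler0_norm; lra. Qed.

Lemma continuous_clip : continuous clip.
Proof.
move=> u; apply: cvgM; last exact: cvg_cst.
apply: cvgD; last exact: cvg_cst.
apply: cvgB; first by apply: cvg_norm; exact: cvg_id.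
by apply: cvg_norm; apply: cvgB; [exact: cvg_id|exact: cvg_cst].
Qed.

End Clip.

Lemma fset_card_le2 (K : choiceType) (s : {fset K}) : s != fset0 ->
  (#|` s| <= 2)%N -> exists p q, s = [fset p; q]%fset.
Proof.
move=> /fset0Pn[p ps] s2; have [sp|] := eqVneq s [fset p]%fset.
  by exists p, p; rewrite fsetUid.
move=> sNp; have [q] : exists q, q \in (s `\ p)%fset.
  apply/fset0Pn; apply: contraNneq sNp => sp.
  by rewrite -(fsetD1K ps) sp fsetU0.
rewrite !inE => /andP[qp qs]; exists p, q; apply/esym/eqP.
rewrite eqEfcard cardfs2 eq_sym qp s2 andbT; apply/fsubsetP => x.
by rewrite !inE => /orP[] /eqP ->.
Qed.

(** * Segments and faces in a one-dimensional complex *)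

Section Simplices.
Context (R : realType) (n : nat).
Implicit Types (p q x : 'rV[R]_n) (s : {fset 'rV[R]_n}).

Lemma convex_hull1 p x : convex_hull [fset p]%fset x -> x = p.
Proof.
by move=> [c [_]]; rewrite !big_seq_fset1 => -> ->; rewrite scale1r.
Qed.

Lemma convex_hull2 p q x : convex_hull [fset p; q]%fset x <->
  exists2 t : R, 0 <= t <= 1 & x = (1 - t) *: p + t *: q.
Proof.
have [->|pq] := eqVneq p q.
  rewrite fsetUid; split.
    move=> /convex_hull1 ->; exists 0; rewrite ?lexx ?ler01//.
    by rewrite subr0 scale1r scale0r addr0.
  move=> [t t01 ->]; exists (fun=> 1); rewrite !big_seq_fset1; split => //.
  by rewrite -scalerDl subrK.
have pNq : p \notin [fset q]%fset by rewrite inE.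
split.
  move=> [c [c0]]; rewrite !(big_fsetU1 _ _ pNq)/= !big_seq_fset1 => c1 ->.
  exists (c q); last by rewrite -c1 addrK.
  by have := c0 p (fset21 _ _); have := c0 q (fset22 _ _); lra.
move=> [t t01 ->]; exists (fun v => if v == p then 1 - t else t); split.
- by move=> v _; case: ifP; lra.
- by rewrite (big_fsetU1 _ _ pNq)/= big_seq_fset1 eqxx eq_sym (negbTE pq) subrK.
- by rewrite (big_fsetU1 _ _ pNq)/= big_seq_fset1 eqxx eq_sym (negbTE pq).
Qed.

Lemma segment_endpoint p q t x : p != q -> 0 < t < 1 ->
  x = (1 - t) *: p + t *: q -> x <> p /\ x <> q.
Proof.
move=> pq t01 ->; split => [|] /eqP; rewrite -subr_eq0.
  have -> : (1 - t) *: p + t *: q - p = t *: (q - p).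
    by apply/rowP => i; rewrite !mxE; ring.
  by rewrite scaler_eq0 (subr_eq0 q) [q == p]eq_sym (negbTE pq) orbF => /eqP; lra.
have -> : (1 - t) *: p + t *: q - q = (1 - t) *: (p - q).
  by apply/rowP => i; rewrite !mxE; ring.
by rewrite scaler_eq0 (subr_eq0 p) (negbTE pq) orbF => /eqP; lra.
Qed.

Lemma segment_injective p q (t u : R) : p != q ->
  (1 - t) *: p + t *: q = (1 - u) *: p + u *: q -> t = u.
Proof.
move=> pq /eqP; rewrite -subr_eq0.
have -> : (1 - t) *: p + t *: q - ((1 - u) *: p + u *: q) = (u - t) *: (p - q).
  by apply/rowP => i; rewrite !mxE; ring.
by rewrite scaler_eq0 (subr_eq0 p) (negbTE pq) orbF => /eqP; lra.
Qed.

(** If [s] missed an endpoint, the common face would be at most the other endpoint, and [x] is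
    neither. So [s] contains both, and its size leaves room for nothing else. *)
Lemma edge_interior_simplex p q s t x : p != q -> (#|` s| <= 2)%N -> 0 < t < 1 ->
  x = (1 - t) *: p + t *: q -> convex_hull ([fset p; q] `&` s)%fset x ->
  s = [fset p; q]%fset.
Proof.
move=> pq s2 t01 xE hx; have [xp xq] := segment_endpoint pq t01 xE.
have face (v w : 'rV[R]_n) : x <> w -> v \notin s ->
    convex_hull ([fset v; w] `&` s)%fset x -> False.
  move=> xw vs; have [ws|ws] := boolP (w \in s).
    suff -> : ([fset v; w] `&` s)%fset = [fset w]%fset by move/convex_hull1.
    apply/fsetP => z; rewrite !inE; have [->|] := eqVneq z w; first by rewrite orbT.
    by rewrite orbF; have [->|] := eqVneq z v; rewrite ?(negbTE vs).
  suff -> : ([fset v; w] `&` s)%fset = fset0.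
    by move=> [c [_]]; rewrite big_seq_fset0 => /eqP; rewrite eq_sym oner_eq0.
  apply/fsetP => z; rewrite !inE; have [->|] := eqVneq z w.
    by rewrite orbT (negbTE ws).
  by rewrite orbF; have [->|] := eqVneq z v; rewrite ?(negbTE vs).
have ps : p \in s by apply/negPn/negP => ps; exact: face hx.
have qs : q \in s.
  by apply/negPn/negP => qs; apply: (face q p) => //; rewrite fsetUC.
apply/esym/eqP; rewrite eqEfcard cardfs2 pq s2 andbT; apply/fsubsetP => z.
by rewrite !inE => /orP[] /eqP ->.
Qed.

End Simplices.

(** Each simplex becomes a piece, vertices being constant ones. An interior point of an edge lies on
    no other piece, because two simplices meet in the hull of their common vertices. *)
Lemma graph_arc_decomposition (R : realType) (T : metricType R) :
  topological_graph T ->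
  exists (I : finType) (a : I -> R -> T), arc_decomposition a.
Proof.
move=> [_ [n [K [[K0 _ _ KI] [K2 _] [f [g [fC gT fK gK [_ cg]]]]]]]].
set C := geometric_carrier K in fC gT gK cg.
have /choice[e eP] : forall i : K, exists e, val i = [fset e.1; e.2]%fset.
  move=> i; have [p [q pq]] := fset_card_le2 (K0 _ (fsvalP i)) (K2 _ (fsvalP i)).
  by exists (p, q).
pose k i (u : R) := (1 - clip u) *: (e i).1 + clip u *: (e i).2.
have Ck i u : C (k i u).
  exists (val i); first exact: fsvalP.
  by rewrite eP; apply/convex_hull2; exists (clip u) => //; exact: clip01.
have ck i : continuous (k i).
  move=> u; apply: cvgD; apply: cvgZr_tmp; last exact: continuous_clip.
  by apply: cvgB; [exact: cvg_cst|exact: continuous_clip].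
have gI x y : C x -> C y -> g x = g y -> x = y.
  by move=> Cx Cy gxy; rewrite -(gK x Cx) gxy gK.
exists K, (fun i => g \o k i); split.
- by move=> i; apply: continuous_comp_within cg (ck i) (Ck i).
- move=> x; have [s sK] := fC x I.
  rewrite -[s]/(val (FSetSub sK)) eP => /convex_hull2[t t01 xt].
  exists (FSetSub sK), t => //=; rewrite /k clip_id// -xt; exact: fK.
- move=> i; have [pq|pq] := eqVneq (e i).1 (e i).2.
    by left => u; rewrite /= /k pq -!scalerDl !subrK.
  right; split.
    move=> /(gI _ _ (Ck _ _) (Ck _ _)); rewrite /k !clip_id ?lexx ?ler01//.
    by move=> /(segment_injective pq) /eqP; rewrite eq_sym oner_eq0.
  move=> j u w u01 w01 /(gI _ _ (Ck _ _) (Ck _ _)) kuw.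
  have u01' : 0 <= u <= 1 by lra.
  have kE : k i u = (1 - u) *: (e i).1 + u *: (e i).2 by rewrite /k clip_id.
  have hk : convex_hull (val i `&` val j)%fset (k i u).
    rewrite -(KI _ _ (fsvalP i) (fsvalP j)); split.
      by rewrite eP; apply/convex_hull2; exists u.
    by rewrite eP kuw /k clip_id//; apply/convex_hull2; exists w.
  rewrite [X in (X `&` _)%fset]eP in hk.
  have ji : j = i.
    apply: val_inj; apply: etrans (esym (eP i)).
    exact: edge_interior_simplex pq (K2 _ (fsvalP j)) u01 kE hk.
  split => //; apply: (segment_injective pq).
  by rewrite -kE kuw ji /k clip_id.
Qed.

(** Both orientations of each edge turn two-sided separation into one-sided: a connected set whose
    coordinates keep distance [d] from [c i x] stays on one side of it. *)
Lemma edge_coordinates_of_tree (R : realType) (T : metricType R) :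
  topological_tree T ->
  exists (E : finType) (c : E -> T -> R) (s : E -> R -> T), edge_coordinates c s.
Proof.
move=> [hG nocircle]; have [[T0 cT connT] _] := hG.
have [J [a dec]] := graph_arc_decomposition hG.
have [E [c [s [csc c01 csK scK sep]]]] :=
  decomposition_has_coordinates dec T0 connT nocircle.
have cc i : continuous (c i) by apply/continuous_subspace_setT; have [] := csc i.
exists (E * bool)%type, (fun i x => if i.2 then c i.1 x else 1 - c i.1 x),
  (fun i u => if i.2 then s i.1 u else s i.1 (1 - u)); split.
- move=> [i []] /=; split=> x; [exact: cc|exact: (csc i).2| |].
    by apply: cvgB; [exact: cvg_cst|exact: cc].
  apply: (@continuous_comp R R T (fun u : R => 1 - u) (s i) x).
    by apply: cvgB; [exact: cvg_cst|exact: cvg_id].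
  exact: (csc i).2.
- by move=> [i []] x /=; have := c01 i x I; lra.
- move=> [i []] u u01 /=; first by have [] := csK i u u01.
  by have [|_ -> _] := csK i (1 - u); lra.
- move=> [i []] x /= cx; first exact: scK.
  by rewrite opprB addrC subrK scK//; lra.
move=> e e0; have [d d0 dP] := sep e e0; exists d => // B x B0 cB far.
have [i iP] : exists i, forall y, B y -> d <= `|c i x - c i y|.
  apply: contrapT => none; have [||i|y By xy] := dP B x B0 cB; [by []|by []| |].
    apply: contrapT => nBi; apply: none; exists i => y By; rewrite leNgt.
    by apply/negP => xy; apply: nBi; exists y.
  by have := far y By; lra.
have [low|nlow] := pselect (forall y, B y -> c i x + d <= c i y).
  by exists (i, true).
exists (i, false) => y By /=.
(* Some [z] in [B] is not above [x], hence below it; a point of [B] above [x] would then yield one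
   with the coordinate of [x]. *)
have [z Bz zx] : exists2 z, B z & c i z < c i x + d.
  apply: contrapT => nz; apply: nlow => z Bz; rewrite leNgt; apply/negP => zx.
  by apply: nz; exists z.
have zx' : c i z <= c i x.
  by have := iP z Bz; rewrite ler_normr => /orP[]; lra.
have [yx|/ltW xy] := leP (c i y) (c i x).
  by have := iP y By; rewrite ger0_norm ?subr_ge0//; lra.
have [w Bw wx] := connected_ivt cB (continuous_subspaceT (cc i)) Bz By zx' xy.
by have := iP w Bw; rewrite wx subrr normr0; lra.
Qed.

Theorem theorem1p2 (R : realType) (T : metricType R) (hT : topological_tree T)
    (f : T -> T) (hf : continuous f) :
  almost_equicontinuous (induced_map hf).
Proof.
have [E [c [s cs]]] := edge_coordinates_of_tree hT.
have [[[_ cT _] _] _] := hT.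
exact: edge_coordinates_almost_equicontinuous cs hf cT.
Qed.
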